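(* Let $I=[0,T]$ be a bounded time interval. Let $\mathcal{B}$ be a separable, reflexive, uniformly smooth Banach space which is ''$I$-smoothly weakly compact'' for an exponent $p\in[2,\infty)$. Let $f:\mathcal{B}\to\mathcal{B}$ be a continuous function admitting at most a linear growth, and let $r>0$ be a fixed real. Let $C$ be a nonempty ball-compact $(r,f)$-prox-regular subset of $\mathcal{B}$. Then for all $u_0\in C$, the system $$\dot u(t)+\mathrm{N}(C,u(t))\ni f(u(t))\ \text{ for a.e. } t\in I,\qquad u(0)=u_0,$$ has an absolutely continuous solution $u$, and for all $t\in I$, $u(t)\in C$.
   Context: Banach spaces are real; the norm of $\mathcal{B}$ is $\|\cdot\|$. Projection: for $C\subset\mathcal{B}$ closed and $x\in\mathcal{B}$, $P_C(x):=\{y\in C:\ \|x-y\|=d(x,C)\}$ (a possibly empty or multi-element set; when it is a singleton it is identified with its element). Proximal normal cone: for $x\in C$, $\mathrm{N}(C,x):=\{v\in\mathcal{B}:\ \exists s>0,\ x\in P_C(x+sv)\}$. For $x\in C$ and $r>0$, $\Gamma^r(C,x):=\{v\in\mathcal{B}:\ x\in P_C(x+rv)\}$. Directional prox-regularity: for a mapping $f:\mathcal{B}\to\mathcal{B}$, a closed set $C$ is $(r,f)$-prox-regular ($r$-prox-regular in the direction $f$) if for all $x\in C$ and all $s\in(0,r)$: (a) the projection $z:=P_C\left(x+s\frac{f(x)}{\|f(x)\|}\right)$ is well-defined (a single point); and (b) with $y:=x+s\frac{f(x)}{\|f(x)\|}$, one has $\frac{y-z}{\|y-z\|}\in\Gamma^r(C,z)$.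 By convention $\frac{v}{\|v\|}:=0$ if $v=0$. Ball-compact: $C\subset\mathcal{B}$ is ball-compact if for every closed ball $\overline{B}(x,R)$ the set $\overline{B}(x,R)\cap C$ is compact (in particular $C$ is closed). At most linear growth: there exists $L>0$ with $\|f(x)\|\le L(1+\|x\|)$ for all $x\in\mathcal{B}$. Uniformly smooth: a Banach space $E$ is uniformly smooth if $\lim_{t\to0}\frac{\|x_0+th\|_E-\|x_0\|_E}{t}$ exists uniformly with respect to unit vectors $x_0,h$. For uniformly smooth $E$ and $p\in(1,\infty)$, $x\mapsto\|x\|_E^p$ is $C^1$ on $E$ and $J_p(x):=\frac1p(\nabla\|\cdot\|_E^p)(x)\in E^*$. $I$-smoothly weakly compact: a separable reflexive uniformly smooth Banach space $E$ is $I$-smoothly weakly compact for an exponent $p\in(1,\infty)$ if from every bounded sequence $(x_n)_{n\ge0}$ of $L^\infty(I,E)$ one can extract a subsequence $(y_n)_{n\ge0}$ converging weakly to some $y\in L^\infty(I,E)$ (weak convergence in $L^\infty(I,E)=[L^1(I,E^* )]^*$, i.e. tested against $L^1(I,E^* )$) such that for all $z\in L^\infty(I,E)$ and $\phi\in L^1(I,\mathbb{R})$, $$\lim_{n\to\infty}\int_I\langle J_p(z(t)+y_n(t))-J_p(y_n(t)),y_n(t)\rangle\,\phi(t)\,dt=\int_I\langle J_p(z(t)+y(t))-J_p(y(t)),y(t)\rangle\,\phi(t)\,dt,$$ where $\langle\cdot,\cdot\rangle$ is the $E^*$–$E$ duality pairing. *)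

(* Defs.v *)
From HB Require Import structures.
From mathcomp Require Import all_boot all_order all_algebra.
From mathcomp Require Import all_classical all_reals all_analysis.

Set Implicit Arguments.
Unset Strict Implicit.
Unset Printing Implicit Defensive.

Import Order.TTheory GRing.Theory Num.Theory.
Import numFieldNormedType.Exports.

Local Open Scope classical_set_scope.
Local Open Scope ring_scope.

(* The topological dual of E, a normed space for the operator norm. *)
Section dual.
Context {R : realType} (E : normedModType R).

Definition continuous_linear_pred : {pred E -> R^o} :=
  mem [set phi : E -> R^o | linear phi /\ continuous phi].

Record dual_space := Dual {
  dual_fun :> E -> R^o;
  dual_funP : dual_fun \in continuous_linear_pred
}.

HB.instance Definition _ := [isSub for dual_fun].
HB.instance Definition _ := [Choice of dual_space by <:].

Lemma continuous_linear_submod_closed : submod_closed continuous_linear_pred.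
Proof.
split=> [|a f g].
  rewrite inE; split; first by move=> a x y /=; rewrite scaler0 addr0.
  by move=> x; exact: cvg_cst.
rewrite !inE => -[lf cf] [lg cg]; split=> [b x y|x] /=.
  rewrite -![(a *: f + g) _]/(a *: f _ + g _) lf lg.
  by rewrite !scalerDr !scalerA [a * b]mulrC addrACA.
apply: (@cvgD R R^o E _ _ (a \*: f) g); last exact: cg.
by apply: cvgZl_tmp; exact: cf.
Qed.

HB.instance Definition _ := GRing.isSubmodClosed.Build _ _ continuous_linear_pred
  continuous_linear_submod_closed.
HB.instance Definition _ := [SubChoice_isSubLmodule of dual_space by <:].

Definition dual_norm (phi : dual_space) : R :=
  sup [set `|phi x| | x in [set x : E | `|x| <= 1]].

Lemma dual_linear (phi : dual_space) : linear phi.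
Proof. by have := dual_funP phi; rewrite inE => -[]. Qed.

Lemma dual_continuous (phi : dual_space) : continuous phi.
Proof. by have := dual_funP phi; rewrite inE => -[]. Qed.

Lemma dual_has_sup (phi : dual_space) :
  has_sup [set `|phi x| | x in [set x : E | `|x| <= 1]].
Proof.
split; first by exists `|phi 0|, 0 => //=; rewrite normr0.
pose L := GRing.isLinear.Build R E R^o *:%R phi (@dual_linear phi).
pose f : {linear E -> R^o} := HB.pack (phi : E -> R^o) L.
have /linear_bounded_continuous/bounded_funP/(_ 1)[M MP] : continuous f.
  exact: dual_continuous.
by exists M => _ [x x1 <-]; exact: MP.
Qed.

Lemma dual_norm_ub (phi : dual_space) x : `|x| <= 1 -> `|phi x| <= dual_norm phi.
Proof.
move=> x1; apply: ub_le_sup; first by case: (dual_has_sup phi).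
by exists x.
Qed.

Lemma dual_norm_ge0 (phi : dual_space) : 0 <= dual_norm phi.
Proof. by rewrite (le_trans _ (@dual_norm_ub phi 0 _)) ?normr0. Qed.

Lemma dual_normD (phi psi : dual_space) :
  dual_norm (phi + psi) <= dual_norm phi + dual_norm psi.
Proof.
apply: ge_sup; first by case: (dual_has_sup (phi + psi)).
move=> _ [x x1 <-]; apply: (le_trans (ler_normD (phi x) (psi x))).
by rewrite lerD ?dual_norm_ub.
Qed.

Lemma dual_normZ (a : R) (phi : dual_space) :
  dual_norm (a *: phi) = `|a| * dual_norm phi.
Proof.
have le_normZ (b : R) (psi : dual_space) :
    dual_norm (b *: psi) <= `|b| * dual_norm psi.
  apply: ge_sup; first by case: (dual_has_sup (b *: psi)).
  move=> _ [x x1 <-]; rewrite -[X in `|X|]/(b * psi x) normrM.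
  by rewrite ler_wpM2l ?dual_norm_ub.
apply/eqP; rewrite eq_le le_normZ/=.
have [->|a0] := eqVneq a 0; first by rewrite normr0 mul0r dual_norm_ge0.
rewrite -ler_pdivlMl ?normr_gt0// -normfV.
have := le_normZ a^-1 (a *: phi).
by rewrite scalerA mulVf// scale1r.
Qed.

Lemma dual_norm0_eq0 (phi : dual_space) : dual_norm phi = 0 -> phi = 0.
Proof.
move=> phi0; apply/val_inj/funext => x /=.
have phi00 : phi 0 = 0.
  by have := dual_linear phi (-1) 0 0; rewrite scaler0 addr0 scaleN1r addNr.
have [->//|x0] := eqVneq x 0.
have /eqP : phi (`|x|^-1 *: x) = 0.
  apply/eqP; rewrite -normr_eq0 eq_le normr_ge0 andbT -phi0 dual_norm_ub//.
  by rewrite normrZ normfV normr_id mulVf ?normr_eq0.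
have := dual_linear phi (`|x|^-1) x 0; rewrite addr0 => ->.
rewrite phi00 addr0 scaler_eq0 invr_eq0 normr_eq0 (negbTE x0)/=.
by move/eqP.
Qed.

HB.instance Definition _ :=
  Lmodule_isNormed.Build R dual_space dual_normD dual_normZ dual_norm0_eq0.

End dual.

Section banach_spaces.
Context {R : realType}.

Definition separable_space (E : normedModType R) :=
  exists2 D : set E, countable D & dense D.

Definition reflexive_space (E : normedModType R) :=
  forall Phi : dual_space (dual_space E),
    exists x : E, forall phi : dual_space E, Phi phi = phi x.

Definition uniformly_smooth (E : normedModType R) :=
  exists l : E -> E -> R, forall eps : R, 0 < eps ->
    \forall t \near (0 : R)^', forall x0 h : E, `|x0| = 1 -> `|h| = 1 ->
      `| (`|x0 + t *: h| - `|x0|) / t - l x0 h | < eps.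

(* < J_p(x), v >; 'd is the Frechet differential, which exists for p > 1 when E
   is uniformly smooth. *)
Definition duality_map (E : normedModType R) (p : R) (x v : E) : R :=
  p^-1 * 'd (fun y : E => `|y| `^ p : R^o) x v.

End banach_spaces.

Section bochner.
Context {R : realType} {V : normedModType R}.
Local Notation mu := (@lebesgue_measure R).

Definition simple_fun (s : R -> V) :=
  finite_set (range s) /\ forall v : V, measurable (s @^-1` [set v]).

(* Elements of the Lebesgue-Bochner spaces are handled through representatives
   that are limits of simple functions everywhere on D; every a.e. limit of
   simple functions is a.e. equal to such a function. *)
Definition strongly_measurable (D : set R) (f : R -> V) :=
  exists s : nat -> R -> V, (forall n, simple_fun (s n)) /\
    forall t, D t -> s n t @[n --> \oo] --> f t.

Definition ess_bounded (D : set R) (M : R) (f : R -> V) :=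
  {ae mu, forall t, D t -> `|f t| <= M}.

Definition Linfty_space (D : set R) (f : R -> V) :=
  strongly_measurable D f /\ exists M, ess_bounded D M f.

Definition L1_space (D : set R) (f : R -> V) :=
  strongly_measurable D f /\ mu.-integrable D (fun t => `|f t|%:E).

Definition bounded_Linfty (D : set R) (x : nat -> R -> V) :=
  (forall n, strongly_measurable D (x n)) /\
  exists M, forall n, ess_bounded D M (x n).

Definition absolutely_continuous (a b : R) (u : R -> V) :=
  forall eps : R, 0 < eps -> exists2 delta : R, 0 < delta &
    forall (n : nat) (s t : 'I_n -> R),
      (forall i, [&& a <= s i, s i <= t i & t i <= b]) ->
      trivIset setT (fun i => `]s i, t i[%classic) ->
      \sum_(i < n) (t i - s i) < delta ->
      \sum_(i < n) `|u (t i) - u (s i)| < eps.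

End bochner.

Section smoothly_weakly_compact.
Context {R : realType} (E : normedModType R).
Local Notation mu := (@lebesgue_measure R).

(* Weak convergence in L^oo(I, E) seen as the dual of L^1(I, E^* ). *)
Definition Linfty_weak_cvg (D : set R) (y : nat -> R -> E) (y' : R -> E) :=
  forall g : R -> dual_space E, L1_space D g ->
    \int[mu]_(t in D) g t (y n t) @[n --> \oo] --> \int[mu]_(t in D) g t (y' t).

Definition smoothly_weakly_compact (D : set R) (p : R) :=
  forall x : nat -> R -> E, bounded_Linfty D x ->
  exists k : nat -> nat, {homo k : i j / (i < j)%N} /\
  exists y : R -> E, [/\ Linfty_space D y, Linfty_weak_cvg D (x \o k) y &
    forall (z : R -> E) (phi : R -> R),
      Linfty_space D z -> mu.-integrable D (EFin \o phi) ->
      \int[mu]_(t in D) ((duality_map p (z t + x (k n) t) (x (k n) t)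
                           - duality_map p (x (k n) t) (x (k n) t)) * phi t)
        @[n --> \oo] -->
      \int[mu]_(t in D) ((duality_map p (z t + y t) (y t)
                           - duality_map p (y t) (y t)) * phi t)].

End smoothly_weakly_compact.

Section sweeping.
Context {R : realType} {B : normedModType R}.
Implicit Types (C : set B) (f : B -> B) (x v : B).

Definition dist_set x C : R := inf [set `|x - y| | y in C].

Definition projection C x : set B := [set y | C y /\ `|x - y| = dist_set x C].

(* Membership of x in C is implied by x being a projection onto C. *)
Definition normal_cone C x : set B :=
  [set v | exists2 s : R, 0 < s & projection C (x + s *: v) x].

Definition Gamma (r : R) C x : set B := [set v | projection C (x + r *: v) x].

(* Since 0^-1 = 0 in a field, normalize 0 = 0. *)
Definition normalize v : B := `|v|^-1 *: v.

Definition prox_regular (r : R) f C :=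
  closed C /\
  forall x, C x -> forall s : R, 0 < s < r ->
    let y := x + s *: normalize (f x) in
    exists2 z, projection C y = [set z] & Gamma r C z (normalize (y - z)).

Definition ball_compact C :=
  forall x (e : R), 0 < e -> compact (closed_ball x e `&` C).

Definition linear_growth f :=
  exists2 L : R, 0 < L & forall x, `|f x| <= L * (1 + `|x|).

End sweeping.

(* Main.v *)
From HB Require Import structures.
Require Import Defs.
From mathcomp Require Import all_boot all_order all_algebra.
From mathcomp Require Import all_classical all_reals all_analysis.
From mathcomp Require Import measurable_realfun.
From mathcomp Require Import ring lra.

(** The solution is a limit of the catching-up scheme U (k+1) = P_C (U k + h f (U k)).
    Prox-regularity in the direction f makes the projection a single point as soon as
    h |f (U k)| < r, and linear growth bounds the scheme on [0, T] uniformly in h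
    ([discrete_solution_exists]).  Write the velocity as f (U k) - d, where d is the
    discrete normal, of norm at most M.  It satisfies |q d + (U (k+1) - c)| >= q |d| for
    all c in C, with one constant q = r / M; equivalently |d| <= |w + d| with
    w = (U (k+1) - c) / q.

    Compactness.  The velocities converge weakly along a subsequence.  Hence phi (U (t))
    converges at every time t, for every functional phi of norm at most 1; since C is ball-compact,
    U (t) converges in norm ([compact_weak_cvg], [position_cvg]).  Along a further subsequence
    the normals converge weakly to some y, and the limit u satisfies
    phi (u (t)) = phi (u0) + int_0^t phi (f (u) - y) ([limit_weak_formula]).  So u is Lipschitz, and
    Lebesgue differentiation of the functions |f (u) - y - v|, for v in a countable dense
    set, shows that u is derivable almost everywhere with derivative f (u) - y
    ([primitive_derivable]).  Norming functionals come from the derivative of the norm, so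
    that uniform smoothness replaces the Hahn-Banach theorem.

    The normal condition.  It remains to see that y (t) is normal to C at u (t), that is,
    |y| <= |w + y| almost everywhere, for w = (u - c) / q and c in a countable dense subset of C.
    The discrete inequality passes to the strong limit in w without difficulty, but it is
    not weakly closed in d: this is the place where smooth weak compactness enters.  It
    controls the pairings <J_p (z + d) - J_p (d), d>, and these determine the
    increments of the norm.  Indeed k (s) = |w + s d|^p is convex with k' (s) = p <J_p (w + s d), d>,
    and J_p is homogeneous of degree p - 1, so subtracting the same identity for w = 0 gives
        |w + d|^p - |d|^p = |w|^p
          + int_0^1 p s^(p-1) <J_p (w / s + d) - J_p (d), d> ds.
    The Riemann sums of this integral converge at a rate that depends only on bounds for w and d
    ([riemann_duality_map]), because the derivative of a convex function is monotone.
    Therefore the limits in the mesh and in the sequence can be exchanged, and the integrals of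
    |w + d_n|^p - |d_n|^p over measurable sets converge ([increment_cvg]), which yields
    the inequality for y ([norm_weak_limit_le]). *)

Set Implicit Arguments.
Unset Strict Implicit.
Unset Printing Implicit Defensive.

Import Order.TTheory GRing.Theory Num.Theory.
Import numFieldNormedType.Exports.

Local Open Scope classical_set_scope.
Local Open Scope ring_scope.

(** * Differentiability of the norm *)

Section geometry.
Context {R : realType} {E : normedModType R}.
Implicit Types (x y v w h : E).

Lemma differentiable_epsilon (F : E -> R^o) (dF : E -> R^o) (x : E) (M : R) :
  linear dF -> (forall h, `|dF h| <= M * `|h|) ->
  (forall e : R, 0 < e -> exists2 d : R, 0 < d & forall h, `|h| < d ->
     `|F (x + h) - F x - dF h| <= e * `|h|) ->
  differentiable F x /\ forall v, 'd F x v = dF v.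
Proof.
move=> linF bF dFx.
pose L0 := GRing.isLinear.Build R E R^o *:%R dF linF.
pose L : {linear E -> R^o} := HB.pack dF L0.
have cL : continuous L.
  apply/linear_bounded_continuous/bounded_funP => r.
  exists (`|M| * r) => y yr; apply: (le_trans (bF y)).
  apply: (@le_trans _ _ (`|M| * `|y|)); first by rewrite ler_wpM2r// ler_norm.
  by rewrite ler_wpM2l.
have expF : F \o shift x = cst (F x) + L +o_ 0 id.
  apply/eqaddoP => e e0; have [d d0 hd] := dFx _ e0.
  apply/nbhs_ballP; exists d => //= h; rewrite -ball_normE/= sub0r normrN => hd0.
  have := hd _ hd0; rewrite /= [x + h]addrC.
  by rewrite opprD addrA.
have dE := diff_unique cL expF.
split; last by move=> v; rewrite dE.
by apply/diff_locallyP; rewrite dE; split.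
Qed.

Hypothesis smooth : uniformly_smooth E.

(** Uniform smoothness speaks of unit vectors and of both signs of t.  Scaling turns it into
    a first-order expansion at x that is uniform in the direction, for the increments h
    and - h with the same value L h; linearity of L is not known yet. *)
Lemma norm_expansion x : x != 0 -> exists L : E -> R,
  [/\ forall (t : R) h, 0 < t -> L (t *: h) = t * L h,
      forall e : R, 0 < e -> exists2 d : R, 0 < d & forall h, `|h| < d ->
        `| `|x + h| - `|x| - L h | <= e * `|h| &
      forall e : R, 0 < e -> exists2 d : R, 0 < d & forall h, `|h| < d ->
        `| `|x - h| - `|x| + L h | <= e * `|h|].
Proof.
move=> x0; have [l hl] := smooth.
have nx0 : 0 < `|x| by rewrite normr_gt0.
pose unit_dir v := `|v|^-1 *: v.
have unit_norm v : v != 0 -> `|unit_dir v| = 1.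
  by move=> v0; rewrite normrZ normfV normr_id mulVf// normr_eq0.
have unitK v : v != 0 -> v = `|v| *: unit_dir v.
  by move=> v0; rewrite scalerA mulfV ?scale1r// normr_eq0.
pose L h := `|h| * l (unit_dir x) (unit_dir h).
have expand (e : R) : 0 < e -> exists2 d : R, 0 < d &
    forall (b : bool) h, `|h| < d ->
      `| `|x + (-1) ^+ b *: h| - `|x| - (-1) ^+ b * L h | <= e * `|h|.
  move=> e0; have /nbhs_ballP[d /= d0 hd] := hl _ e0.
  exists (d * `|x|); first by rewrite mulr_gt0.
  move=> b h hlt; have [->|h0] := eqVneq h 0.
    by rewrite /L normr0 scaler0 addr0 subrr mul0r !mulr0 subrr normr0.
  have nh0 : 0 < `|h| by rewrite normr_gt0.
  pose t := (-1) ^+ b * (`|h| / `|x|).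
  have t0 : t != 0.
    by rewrite mulf_neq0 ?signr_eq0// mulf_neq0 ?invr_eq0 ?gt_eqF.
  have tx : t * `|x| = (-1) ^+ b * `|h| by rewrite /t -mulrA mulfVK// gt_eqF.
  have td : ball (0 : R) d t.
    rewrite /ball /= sub0r normrN /t normrM normr_sign mul1r ger0_norm.
      by rewrite ltr_pdivrMr.
    by rewrite divr_ge0.
  have := hd _ td t0 _ _ (unit_norm _ x0) (unit_norm _ h0).
  rewrite unit_norm// => /ltW; rewrite -(ler_pM2r nh0) => /(le_trans _); apply.
  have -> : x + (-1) ^+ b *: h = `|x| *: (unit_dir x + t *: unit_dir h).
    by rewrite scalerDr -unitK// scalerA [_ * t]mulrC tx -scalerA -unitK.
  rewrite normrZ normr_id /L; set n := `|_ + _ *: _|.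
  set q := l _ _.
  have qE : n - 1 = t * ((n - 1) / t) by rewrite mulrC divfK.
  have -> : `|x| * n - `|x| - (-1) ^+ b * (`|h| * q) =
      (-1) ^+ b * `|h| * ((n - 1) / t - q).
    by rewrite mulrBr -{1}tx mulrAC -qE mulrA; ring.
  by rewrite normrM normrM normr_sign mul1r normr_id mulrC.
exists L; split.
- move=> t h t0; rewrite /L /unit_dir normrZ gtr0_norm// -mulrA; do 2 congr (_ * _).
  congr l; rewrite scalerA invfM mulrAC mulVf ?mul1r// gt_eqF//.
- move=> e /expand[d d0 hd]; exists d => // h hlt.
  by have := hd false h hlt; rewrite expr0 scale1r mul1r.
- move=> e /expand[d d0 hd]; exists d => // h hlt.
  by have := hd true h hlt; rewrite expr1 scaleN1r mulN1r opprK.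
Qed.

(** Applying the two expansions to s h with small s gives L (- h) = - L h.  Convexity of
    the norm, |x + s (h + k)| <= (|x + 2 s h| + |x + 2 s k|) / 2, gives subadditivity;
    an odd subadditive function is additive. *)
Lemma norm_gateaux_linear x (L : E -> R) :
  (forall (t : R) h, 0 < t -> L (t *: h) = t * L h) ->
  (forall e : R, 0 < e -> exists2 d : R, 0 < d & forall h, `|h| < d ->
     `| `|x + h| - `|x| - L h | <= e * `|h|) ->
  (forall e : R, 0 < e -> exists2 d : R, 0 < d & forall h, `|h| < d ->
     `| `|x - h| - `|x| + L h | <= e * `|h|) ->
  linear (L : E -> R^o).
Proof.
move=> Lpos Lp Lm.
have small (d a : R) : 0 < d -> 0 <= a -> exists2 s : R, 0 < s & s * a < d.
  move=> d0 a0; exists (d / (a + 1)).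
    by rewrite divr_gt0// ltr_wpDl.
  by rewrite mulrAC ltr_pdivrMr ?ltr_wpDl// ltr_pM2l// ltrDl.
have sqz (a b : R) : 0 <= b -> (forall e : R, 0 < e -> `|a| <= e * b) -> a = 0.
  move=> b0 ab; apply/eqP; rewrite -normr_le0; apply/ler_addgt0Pr => e e0.
  rewrite add0r; apply: (le_trans (ab _ (divr_gt0 e0 (ltr_wpDl b0 ltr01)))).
  by rewrite mulrAC ler_pdivrMr ?ltr_wpDl// ler_pM2l// lerDl.
have Lodd h : L (- h) = - L h.
  apply/eqP; rewrite -subr_eq0 opprK; apply/eqP/(sqz _ (`|h| + `|h|)) => [|e e0].
    by rewrite addr_ge0.
  have [d d0 hd] := Lp _ e0; have [d' d'0 hd'] := Lm _ e0.
  have dd : 0 < Num.min d d' by rewrite lt_min d0.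
  have [s s0] := small _ `|h| dd (normr_ge0 _); rewrite lt_min => /andP[sd sd'].
  have nsh : `|s *: h| = s * `|h| by rewrite normrZ gtr0_norm.
  have := hd' (s *: h); rewrite nsh => /(_ sd') h1.
  have := hd (s *: (- h)); rewrite scalerN normrN nsh -scalerN Lpos// => /(_ sd) h2.
  rewrite -(ler_pM2l s0) -[X in X * `| _ |]gtr0_norm// -normrM.
  have -> : s * (L (- h) + L h) = (`|x - s *: h| - `|x| + L (s *: h)) -
     (`|x + s *: - h| - `|x| - s * L (- h)).
    by rewrite scalerN Lpos//; ring.
  apply: (le_trans (ler_normB _ _)).
  by rewrite mulrDr mulrDr lerD// mulrCA.
have Lsub h k : L (h + k) <= L h + L k.
  suff sub (e : R) : 0 < e -> L (h + k) <= L h + L k + e by apply/ler_addgt0Pr.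
  move=> e0; pose a := `|h| + `|k| + `|h + k|.
  have a0 : 0 <= a by rewrite !addr_ge0.
  have e'0 : 0 < e / (a + 1) by rewrite divr_gt0// ltr_wpDl.
  have [d d0 hd] := Lp _ e'0.
  have [s s0 sd] := small _ (2 * a) d0 (mulr_ge0 (ler0n R 2) a0).
  have ns (t : R) v : 0 < t -> `|t *: v| = t * `|v| by move=> ?; rewrite normrZ gtr0_norm.
  have s20 : 0 < 2 * s by rewrite mulr_gt0.
  have := hd (s *: (h + k)); rewrite ns// Lpos// => /(_ _) h1.
  have := hd ((2 * s) *: h); rewrite ns// Lpos// => /(_ _) h2.
  have := hd ((2 * s) *: k); rewrite ns// Lpos// => /(_ _) h3.
  have {}h1 := h1 ltac:(rewrite /a in sd; have := normr_ge0 h; have := normr_ge0 k;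
    have := normr_ge0 (h + k); nra).
  have {}h2 := h2 ltac:(rewrite /a in sd; have := normr_ge0 h; have := normr_ge0 k;
    have := normr_ge0 (h + k); nra).
  have {}h3 := h3 ltac:(rewrite /a in sd; have := normr_ge0 h; have := normr_ge0 k;
    have := normr_ge0 (h + k); nra).
  have cvx : 2 * `|x + s *: (h + k)| <= `|x + (2 * s) *: h| + `|x + (2 * s) *: k|.
    rewrite -[X in X * _]ger0_norm// -normrZ (le_trans _ (ler_normD _ _))//.
    by rewrite scalerDr scaler_nat mulr2n addrACA scalerA scalerDr.
  move: h1 h2 h3; rewrite !ler_norml => /andP[h1 _] /andP[_ h2] /andP[_ h3].
  have ea : e / (a + 1) * a <= e.
    by rewrite mulrAC ler_pdivrMr ?ltr_wpDl// ler_pM2l// lerDl.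
  rewrite -(ler_pM2l s0).
  have : s * (e / (a + 1) * a) <= s * e by rewrite ler_pM2l.
  move: (e / (a + 1) : R) h1 h2 h3 => e' h1 h2 h3; rewrite /a.
  move=> h4; move: h1 h2 h3 h4 cvx; clear.
  by lra.
have LD h k : L (h + k) = L h + L k.
  apply/eqP; rewrite eq_le Lsub/=.
  by have := Lsub (- h) (- k); rewrite -opprD !Lodd -opprD lerN2.
have L0 : L 0 = 0 by have := LD 0 0; rewrite addr0; lra.
move=> a h k; rewrite LD; congr (_ + _).
have [a0|a0|->] := ltgtP a 0.
- by rewrite -{1}[a]opprK scaleNr Lodd Lpos ?oppr_gt0// mulNr opprK.
- by rewrite Lpos.
- by rewrite !scale0r L0.
Qed.

End geometry.

Section geometry2.
Context {R : realType} {E : normedModType R}.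
Implicit Types (x y v w h : E).

Lemma harmonic_dnbhs : @harmonic R @ \oo --> (0 : R)^'.
Proof.
move=> A; rewrite /dnbhs /within /= => A0.
have /= := @cvg_harmonic R _ A0.
by apply: (@filterS nat \oo) => n /=; apply; rewrite gt_eqF// harmonic_gt0.
Qed.

Lemma diff_quotient_cvg (F : E -> R^o) x v : differentiable F x ->
  (harmonic n)^-1 * (F (x + (harmonic n : R) *: v) - F x) @[n --> \oo] --> ('d F x v : R).
Proof.
move=> dF; rewrite -(deriveE v dF).
have dFxv : (fun h : R => h^-1 *: ((F \o shift x) (h *: v) - F x)) @ 0^' --> 'D_v F x.
  exact: diff_derivable.
have -> : (fun n => (harmonic n)^-1 * (F (x + (harmonic n : R) *: v) - F x)) =
    (fun h : R => h^-1 *: ((F \o shift x) (h *: v) - F x)) \o harmonic.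
  by apply/funext => n; rewrite /= [x + _]addrC.
exact: cvg_comp harmonic_dnbhs dFxv.
Qed.

Hypothesis smooth : uniformly_smooth E.

Lemma differentiable_norm x : x != 0 -> differentiable (fun y => `|y| : R^o) x.
Proof.
move=> x0; have [L [Lpos Lp Lm]] := norm_expansion smooth x0.
have linL := norm_gateaux_linear Lpos Lp Lm.
have [d d0 hd] := Lp _ ltr01.
have bndL h : `|L h| <= 2 * `|h|.
  have [->|h0] := eqVneq h 0.
    by have := linL (-1) 0 0; rewrite scaler0 addr0 scaleN1r addNr => ->; rewrite !normr0 mulr0.
  have nh0 : 0 < `|h| by rewrite normr_gt0.
  pose s := d / 2 / `|h|.
  have s0 : 0 < s by rewrite !divr_gt0.
  have nsh : `|s *: h| = s * `|h| by rewrite normrZ gtr0_norm.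
  have shE : s * `|h| = d / 2 by rewrite /s divfK// gt_eqF.
  have := hd (s *: h); rewrite nsh Lpos// mul1r shE.
  rewrite ltr_pdivrMr// ltr_pMr// ltr1n => /(_ isT) hs.
  rewrite -(ler_pM2l s0) -[X in X * `|L _|]gtr0_norm// -normrM.
  have tri : `| `|x + s *: h| - `|x| | <= s * `|h|.
    by rewrite -nsh (le_trans (ler_dist_dist _ _))// addrAC subrr add0r.
  move: tri hs; rewrite !ler_norml => /andP[t1 t2] /andP[h1 h2].
  by apply/andP; split; lra.
by have [] := differentiable_epsilon linL bndL Lp.
Qed.

(** The derivative of the norm at x serves as the norming functional of the Hahn-Banach theorem. *)
Lemma norming_functional x : exists phi : dual_space E,
  phi x = `|x| /\ forall v, `|phi v| <= `|v|.
Proof.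
have [->|x0] := eqVneq x 0.
  have ev0 v : (0 : dual_space E) v = 0 by [].
  by exists 0; split=> [|v]; rewrite ev0 normr0.
have dN := differentiable_norm x0; set N := (fun y => _) in dN.
have dNP : ('d N x : E -> R^o) \in @continuous_linear_pred R E.
  rewrite inE; split; last exact: diff_continuous.
  by move=> a u v; rewrite linearP.
exists (Dual dNP); split=> [|v] /=.
  have /cvg_lim <- // := @diff_quotient_cvg N x x dN.
  apply: lim_near_cst => //; near=> n.
  rewrite /N -[X in X + _ *: _]scale1r -scalerDl normrZ.
  rewrite gtr0_norm; last by rewrite addr_gt0 ?harmonic_gt0.
  by rewrite mulrDl mul1r addrAC subrr add0r mulKf// gt_eqF ?harmonic_gt0.
have cN := @diff_quotient_cvg N x v dN.
rewrite -(cvg_lim _ (cvg_norm cN))//.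
apply: limr_le; first by apply/cvg_ex; eexists; exact: (cvg_norm cN).
near=> n; rewrite normrM normfV (gtr0_norm (harmonic_gt0 n)) /N.
rewrite ler_pdivrMl ?harmonic_gt0// (le_trans (ler_dist_dist _ _))//.
by rewrite addrAC subrr add0r normrZ (gtr0_norm (harmonic_gt0 n)).
Unshelve. all: by end_near. Qed.

End geometry2.

Section power.
Context {R : realType} {E : normedModType R}.
Implicit Types (x y v w h : E).
Hypothesis smooth : uniformly_smooth E.
Variable p : R.
Hypothesis p2 : 2 <= p.
Let p0 : 0 < p. Proof. by rewrite (lt_le_trans _ p2). Qed.

(** Away from 0 this is the chain rule; at 0 it holds because |h|^p <= |h|^2 for small h. *)
Lemma differentiable_norm_powR x :
  differentiable (fun y => `|y| `^ p : R^o) x.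
Proof.
have [->|x0] := eqVneq x 0; last first.
  apply: (@differentiable_comp _ _ R^o R^o (fun y => `|y| : R^o) (fun a : R^o => a `^ p : R^o)).
    exact: differentiable_norm.
  apply/derivable1_diffP/derivable_powR.
  by rewrite in_itv/= andbT normr_gt0.
have lin0 : linear (fun _ : E => 0 : R^o) by move=> a u v; rewrite scaler0 addr0.
have [] // := @differentiable_epsilon R E (fun y => `|y| `^ p) (fun=> 0) 0 0 lin0.
  by move=> h; rewrite normr0 mul0r.
move=> e e0; exists (Num.min 1 e); first by rewrite lt_min ltr01.
move=> h; rewrite lt_min => /andP[h1 he].
rewrite add0r normr0 powR0 ?gt_eqF// !subr0 ger0_norm ?powR_ge0//.
have [->|h0] := eqVneq h 0; first by rewrite normr0 powR0 ?gt_eqF// mulr0.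
apply: (@le_trans _ _ (`|h| `^ 2)).
  by apply: ger_powR => //; rewrite normr_gt0 h0 ltW.
by rewrite powR_mulrn// expr2 ler_wpM2r// ltW.
Qed.

Lemma norm_powR_convex x v (t : R) : 0 <= t <= 1 ->
  `|x + t *: v| `^ p <= (1 - t) * `|x| `^ p + t * `|x + v| `^ p.
Proof.
move=> /andP[t0 t1].
have s0 : 0 <= 1 - t by rewrite subr_ge0.
have s1 : 1 - t <= 1 by rewrite gerBl.
apply: (@le_trans _ _ (((1 - t) * `|x| + t * `|x + v|) `^ p)).
  apply: ge0_ler_powR; rewrite ?nnegrE ?(ltW p0)//.
    by rewrite addr_ge0// mulr_ge0.
  have -> : x + t *: v = (1 - t) *: x + t *: (x + v).
    by rewrite scalerDr addrA -scalerDl subrK scale1r.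
  by rewrite (le_trans (ler_normD _ _))// !normrZ (ger0_norm s0) (ger0_norm t0).
have p1 : 1 <= p by rewrite (le_trans _ p2)// ler1n.
have cvx : ((1 - t) * `|x| + (1 - (1 - t)) * `|x + v|) `^ p <=
    (1 - t) * `|x| `^ p + (1 - (1 - t)) * `|x + v| `^ p.
  by apply: (convex_powR p1 (Itv01 s0 s1)); rewrite !inE/= !in_itv/= andbT.
by rewrite subKr in cvx.
Qed.

(** By convexity, the difference quotients of |.|^p at x in the direction v are at most
    |x + v|^p - |x|^p. *)
Lemma duality_map_subgradient x v :
  `|x| `^ p + p * duality_map p x v <= `|x + v| `^ p.
Proof.
have cF := @diff_quotient_cvg _ _ (fun y => `|y| `^ p) x v (differentiable_norm_powR x).
rewrite addrC -lerBrDr /duality_map mulVKf ?gt_eqF// -(cvg_lim _ cF)//.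
apply: limr_le; first by apply/cvg_ex; eexists; exact: cF.
near=> n; have h0 := @harmonic_gt0 R n.
rewrite ler_pdivrMl// lerBlDr (le_trans (@norm_powR_convex _ _ _ _))//.
  rewrite ltW//= /harmonic/= invf_le1// ler1n//.
by move: (harmonic n) => h; lra.
Unshelve. all: by end_near. Qed.

Lemma duality_mapN x v : duality_map p x (- v) = - duality_map p x v.
Proof. by rewrite /duality_map linearN mulrN. Qed.

Lemma duality_mapZ x (t : R) v : duality_map p x (t *: v) = t * duality_map p x v.
Proof. by rewrite /duality_map linearZ /= mulrCA. Qed.

(** The difference quotients in the directions v and - v bound A v from both sides, and their
    limits are opposite. *)
Lemma subgradient_unique x (A : E -> R) :
  (forall t v, A (t *: v) = t * A v) ->
  (forall v, `|x| `^ p + p * A v <= `|x + v| `^ p) ->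
  forall v, A v = duality_map p x v.
Proof.
move=> AZ Asub v.
have Ale w : A w <= duality_map p x w.
  have cF := @diff_quotient_cvg _ _ (fun y => `|y| `^ p) x w (differentiable_norm_powR x).
  rewrite /duality_map ler_pdivlMl// -(cvg_lim _ cF)//.
  apply: limr_ge; first by apply/cvg_ex; eexists; exact: cF.
  near=> n; have h0 := @harmonic_gt0 R n.
  rewrite ler_pdivlMl//.
  have := Asub ((harmonic n : R) *: w); rewrite AZ; set h := harmonic n.
  by rewrite addrC -lerBrDr mulrCA.
apply/eqP; rewrite eq_le Ale/=.
have := Ale (- v); rewrite duality_mapN -scaleN1r AZ mulN1r lerN2//.
Unshelve. all: by end_near. Qed.

(** Rescaling the subgradient inequality at s x gives a subgradient at x. *)
Lemma duality_map_homogeneous (s : R) x v : 0 < s ->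
  duality_map p (s *: x) v = s `^ (p - 1) * duality_map p x v.
Proof.
move=> s0; have sp0 : 0 < s `^ (p - 1) by rewrite powR_gt0.
have spE : s `^ p = s `^ (p - 1) * s.
  by rewrite -{3}(powRr1 (ltW s0)) -powRD ?subrK// gt_eqF// implybT.
rewrite -[LHS](mulVKf (lt0r_neq0 sp0)); congr (_ * _).
apply: (@subgradient_unique x (fun w => (s `^ (p - 1))^-1 * duality_map p (s *: x) w)).
  by move=> t w; rewrite duality_mapZ mulrCA.
move=> w; have := duality_map_subgradient (s *: x) (s *: w).
rewrite -scalerDr !normrZ (gtr0_norm s0) !powRM ?(ltW s0)// spE.
rewrite duality_mapZ.
set d := duality_map _ _ _; set q := s `^ _ in sp0 * => h.
rewrite -(ler_pM2l sp0) -(ler_pM2l s0).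
have -> : s * (q * (`|x| `^ p + p * (q^-1 * d))) =
    q * s * `|x| `^ p + p * (s * (q / q * d)) by ring.
by rewrite mulfV ?gt_eqF// mul1r [leRHS]mulrCA [leRHS]mulrA.
Qed.

Lemma duality_map_le x v : `|duality_map p x v| <= (`|x| + `|v|) `^ p.
Proof.
have ub w : duality_map p x w <= (`|x| + `|w|) `^ p.
  have [|dm0] := leP (duality_map p x w) 0.
    by move=> /le_trans; apply; exact: powR_ge0.
  apply: (@le_trans _ _ (p * duality_map p x w)).
    by rewrite ler_peMl ?(ltW dm0)// (le_trans _ p2)// ler1n.
  apply: (@le_trans _ _ (`|x + w| `^ p)).
    by rewrite (le_trans _ (duality_map_subgradient x w))// lerDr powR_ge0.
  by rewrite ge0_ler_powR ?nnegrE ?(ltW p0) ?addr_ge0// ler_normD.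
by rewrite ler_norml ub lerNl -duality_mapN -(normrN v) ub.
Qed.

(** The subgradient inequality at x in the unit direction of x - y. *)
Lemma norm_powR_lipschitz x y :
  `|x| `^ p - `|y| `^ p <= p * (`|x| + 1) `^ p * `|x - y|.
Proof.
have [->|xy] := eqVneq x y; first by rewrite !subrr normr0 mulr0.
have nxy : 0 < `|x - y| by rewrite normr_gt0 subr_eq0.
have := duality_map_subgradient x (y - x); rewrite subrKC => sub.
pose n := `|x - y|^-1 *: (x - y).
have n1 : `|n| = 1 by rewrite normrZ normfV normr_id mulVf// gt_eqF.
have yx : y - x = - (`|x - y| *: n).
  by rewrite scalerA mulfV ?gt_eqF// scale1r opprB.
have := duality_map_le x n; rewrite n1 ler_norml => /andP[_ dle].
move: sub; rewrite yx duality_mapN duality_mapZ => sub.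
have : p * (`|x - y| * duality_map p x n) <= p * (`|x - y| * (`|x| + 1) `^ p).
  by rewrite ler_pM2l// ler_pM2l.
lra.
Qed.

End power.

(** * The increment of the norm as a mean of duality pairings *)

Section riemann.
Context {R : realType} {E : normedModType R}.
Hypothesis smooth : uniformly_smooth E.
Variable p : R.
Hypothesis p2 : 2 <= p.
Implicit Types (w d : E).

(** For the convex function k(s) = |w + s d|^p, each increment of k over a step lies
    between the values of k' at its two ends, multiplied by the step; the errors
    telescope to k'(1) - k'(0), multiplied by the step. *)
Lemma riemann_segment w d (N : nat) :
  0 <= N.+1%:R^-1 * (\sum_(k < N.+1) p * duality_map p (w + (k.+1%:R / N.+1%:R) *: d) d)
       - (`|w + d| `^ p - `|w| `^ p)
    <= 2 * p * (`|w| + 2 * `|d|) `^ p / N.+1%:R.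
Proof.
have p0 : 0 < p by rewrite (lt_le_trans _ p2).
set h : R := N.+1%:R^-1; have h0 : 0 < h by rewrite invr_gt0.
pose x k : E := w + (k%:R * h) *: d.
pose a k : R := `|x k| `^ p; pose g k : R := p * duality_map p (x k) d.
have xS k : x k.+1 = x k + h *: d by rewrite /x -addrA -scalerDl -natr1 mulrDl mul1r.
have lo k : h * g k <= a k.+1 - a k.
  have := duality_map_subgradient smooth p2 (x k) (h *: d).
  by rewrite duality_mapZ -xS -/(a _) -/(a _) /g => ?; lra.
have up k : a k.+1 - a k <= h * g k.+1.
  have := duality_map_subgradient smooth p2 (x k.+1) (- (h *: d)).
  rewrite duality_mapN duality_mapZ {3}xS addrK -/(a _) -/(a _) /g => ?; lra.
have xN : x N.+1 = w + d by rewrite /x /h divff ?pnatr_eq0// scale1r.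
have x0 : x 0%N = w by rewrite /x mul0r scale0r addr0.
have tel (f : nat -> R) : \sum_(k < N.+1) (f k.+1 - f k) = f N.+1 - f 0%N.
  by rewrite -(big_mkord xpredT (fun k => f k.+1 - f k)) telescope_sumr.
have aE : `|w + d| `^ p - `|w| `^ p = \sum_(k < N.+1) (a k.+1 - a k).
  by rewrite tel /a xN x0.
rewrite aE mulr_sumr -sumrB; apply/andP; split.
  by apply: sumr_ge0 => k _; rewrite subr_ge0; exact: up.
apply: (@le_trans _ _ (\sum_(k < N.+1) (h * g k.+1 - h * g k))).
  by apply: ler_sum => k _; rewrite lerD2l lerN2; exact: lo.
rewrite (tel (fun k => h * g k)) -mulrBr mulrC ler_pM2r// /g xN x0 -mulrBr.
rewrite -[leRHS]mulrA [leRHS]mulrCA ler_pM2l//.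
set K := (X in _ <= 2 * X).
have le1 : `|duality_map p (w + d) d| <= K.
  rewrite (le_trans (duality_map_le smooth p2 _ _))//.
  rewrite ge0_ler_powR ?nnegrE ?(ltW p0)// ?addr_ge0 ?mulr_ge0//.
  by rewrite mulr2n mulrDl !mul1r addrA lerD2r ler_normD.
have le2 : `|duality_map p w d| <= K.
  rewrite (le_trans (duality_map_le smooth p2 _ _))//.
  rewrite ge0_ler_powR ?nnegrE ?(ltW p0)// ?addr_ge0 ?mulr_ge0//.
  by rewrite lerD2l ler_peMl// ler1n.
by move: le1 le2; rewrite !ler_norml => /andP[_ ?] /andP[? _]; lra.
Qed.

(** Subtracting the case w = 0 from the Riemann sums and using
    J_p(w + s d) = s^(p - 1) J_p(w / s + d), the increment |w + d|^p - |d|^p becomes, up to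
    |w|^p and to an error of order 1/N that is uniform for bounded w and d, a mean of the quantities
    <J_p(z + d) - J_p(d), d> with z = w / s. *)
Lemma riemann_duality_map w d (N : nat) :
  `| (\sum_(k < N.+1) (p / N.+1%:R) * (k.+1%:R / N.+1%:R) `^ (p - 1) *
        (duality_map p ((k.+1%:R / N.+1%:R)^-1 *: w + d) d - duality_map p d d))
     - (`|w + d| `^ p - `|w| `^ p - `|d| `^ p) |
    <= 2 * p * (`|w| + 2 * `|d|) `^ p / N.+1%:R.
Proof.
have p0 : 0 < p by rewrite (lt_le_trans _ p2).
have := riemann_segment w d N; have := riemann_segment 0 d N.
rewrite add0r normr0 powR0 ?gt_eqF// subr0 add0r.
set S0 := _ * (\sum_(k < _) _); set S1 := _ * (\sum_(k < _) _).
have -> : \sum_(k < N.+1) (p / N.+1%:R) * (k.+1%:R / N.+1%:R) `^ (p - 1) *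
        (duality_map p ((k.+1%:R / N.+1%:R)^-1 *: w + d) d - duality_map p d d)
   = S1 - S0.
  rewrite /S1 /S0 -mulrBr -sumrB mulr_sumr; apply: eq_bigr => k _.
  have s0 : 0 < k.+1%:R / N.+1%:R :> R by rewrite divr_gt0.
  rewrite add0r (duality_map_homogeneous smooth p2 _ _ s0).
  have -> : w + (k.+1%:R / N.+1%:R) *: d =
      (k.+1%:R / N.+1%:R) *: ((k.+1%:R / N.+1%:R)^-1 *: w + d).
    by rewrite scalerDr scalerA mulfV ?gt_eqF// scale1r.
  by rewrite (duality_map_homogeneous smooth p2 _ _ s0); ring.
have le2 : 2 * p * (2 * `|d|) `^ p / N.+1%:R <= 2 * p * (`|w| + 2 * `|d|) `^ p / N.+1%:R.
  rewrite ler_pM2r// ler_pM2l ?mulr_gt0//.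
  by rewrite ge0_ler_powR ?nnegrE ?(ltW p0)// ?addr_ge0 ?mulr_ge0// lerDr.
move=> /andP[h1 h2] /andP[h3 h4]; rewrite ler_norml.
move: h1 h2 h3 h4 le2; clearbody S0 S1.
move: (2 * p * (2 * `|d|) `^ p / _) (2 * p * (`|w| + _) `^ p / _) => K0 K1 *.
by apply/andP; split; lra.
Qed.

End riemann.

(** * Strongly measurable functions and integrals *)

Section strong_measurability.
Context {R : realType}.
Implicit Types (D : set R).
Local Notation mu := (@lebesgue_measure R).

Lemma simple_fun_comp2 (V1 V2 V3 : normedModType R) (h : V1 -> V2 -> V3)
    (s1 : R -> V1) (s2 : R -> V2) :
  simple_fun s1 -> simple_fun s2 -> simple_fun (fun t => h (s1 t) (s2 t)).
Proof.
move=> [f1 m1] [f2 m2]; split.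
  apply: (@sub_finite_set _ _ [set h v.1 v.2 | v in range s1 `*` range s2]).
    by move=> _ [t _ <-]; exists (s1 t, s2 t) => //; split; exists t.
  exact/finite_image/finite_setX.
move=> v; rewrite (_ : _ @^-1` _ = \bigcup_(w in
    (range s1 `*` range s2) `&` [set w | h w.1 w.2 = v])
      (s1 @^-1` [set w.1] `&` s2 @^-1` [set w.2])).
  apply: fin_bigcup_measurable.
    by apply: finite_setIl; exact: finite_setX.
  by move=> w _; exact: measurableI.
apply/seteqP; split=> [t /= ht|t [w [_ /= hw] [/= -> ->]]//].
by exists (s1 t, s2 t) => //; split => //; split; exists t.
Qed.

Lemma simple_fun_measurable (s : R -> R^o) : simple_fun s -> measurable_fun setT (s : R -> R).
Proof.
move=> [fs ms] _ Y mY; rewrite setTI.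
rewrite (_ : _ @^-1` _ = \bigcup_(w in range s `&` Y) (s @^-1` [set w])).
  by apply: fin_bigcup_measurable => //; exact: finite_setIl.
apply/seteqP; split=> [t /= ht|t [w [_ /= hw] /= ->]//].
by exists (s t) => //; split => //; exists t.
Qed.

Lemma strongly_measurable_comp2 D (V1 V2 V3 : normedModType R)
    (h : V1 -> V2 -> V3) (f1 : R -> V1) (f2 : R -> V2) :
  continuous (fun z : V1 * V2 => h z.1 z.2) ->
  strongly_measurable D f1 -> strongly_measurable D f2 ->
  strongly_measurable D (fun t => h (f1 t) (f2 t)).
Proof.
move=> ch [s1 [ss1 c1]] [s2 [ss2 c2]]; exists (fun n t => h (s1 n t) (s2 n t)); split.
  by move=> n; exact: simple_fun_comp2.
move=> t Dt.
apply: (@cvg_comp _ _ _ (fun n => (s1 n t, s2 n t)) (fun z => h z.1 z.2)).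
  exact: cvg_pair (c1 t Dt) (c2 t Dt).
exact: (ch (f1 t, f2 t)).
Qed.

Lemma simple_fun_cst (V : normedModType R) (v : V) : simple_fun (fun _ : R => v).
Proof.
split=> [|w]; first by apply: (sub_finite_set _ (finite_set1 v)) => _ [t _ <-].
by rewrite preimage_cst; case: ifP => _.
Qed.

Lemma simple_fun_indic (A : set R) : measurable A -> simple_fun (\1_A : R -> R^o).
Proof.
move=> mA; split.
  apply: (@sub_finite_set _ _ [set 0; 1]); last exact: finite_set2.
  by move=> _ [t _ <-] /=; rewrite indicE; case: (_ \in _); [right|left].
move=> v; have m1 : measurable_fun setT (\1_A : R -> R) by exact: measurable_indic.
by have := m1 measurableT [set v] (measurable_set1 v); rewrite setTI.
Qed.

Lemma strongly_measurable_cst D (V : normedModType R) (v : V) :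
  strongly_measurable D (fun=> v).
Proof.
by exists (fun _ _ => v); split=> [n|t _]; [exact: simple_fun_cst|exact: cvg_cst].
Qed.

Lemma strongly_measurable_comp D (V1 V2 : normedModType R) (h : V1 -> V2) (f : R -> V1) :
  continuous h -> strongly_measurable D f -> strongly_measurable D (h \o f).
Proof.
move=> ch mf; apply: (@strongly_measurable_comp2 D _ _ _ (fun v _ => h v) f f) => //.
by move=> z; apply: (@continuous_comp _ _ _ fst h); [exact: cvg_fst|exact: ch].
Qed.

Lemma strongly_measurable_lin D (V : normedModType R) (a b : R) (z y : R -> V) :
  strongly_measurable D z -> strongly_measurable D y ->
  strongly_measurable D (fun t => a *: z t + b *: y t).
Proof.
move=> mz my.
apply: (@strongly_measurable_comp2 _ _ _ _ (fun u v => a *: u + b *: v)) => //.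
move=> u; apply: (@cvgD _ _ _ _ _ (fun z => a *: z.1) (fun z => b *: z.2)).
  by apply: cvgZl_tmp; exact: cvg_fst.
by apply: cvgZl_tmp; exact: cvg_snd.
Qed.

Lemma strongly_measurableD D (V : normedModType R) (z y : R -> V) :
  strongly_measurable D z -> strongly_measurable D y ->
  strongly_measurable D (fun t => z t + y t).
Proof.
move=> mz my; have := strongly_measurable_lin 1 1 mz my; congr strongly_measurable.
by apply/funext => t; rewrite !scale1r.
Qed.

Lemma strongly_measurableB D (V : normedModType R) (z y : R -> V) :
  strongly_measurable D z -> strongly_measurable D y ->
  strongly_measurable D (fun t => z t - y t).
Proof.
move=> mz my; have := strongly_measurable_lin 1 (-1) mz my; congr strongly_measurable.
by apply/funext => t; rewrite scale1r scaleN1r.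
Qed.

Lemma strongly_measurableZ D (V : normedModType R) (a : R) (z : R -> V) :
  strongly_measurable D z -> strongly_measurable D (fun t => a *: z t).
Proof.
move=> mz; have := strongly_measurable_lin a 0 mz mz; congr strongly_measurable.
by apply/funext => t; rewrite scale0r addr0.
Qed.

Lemma strongly_measurable_real D (f : R -> R^o) :
  measurable D -> strongly_measurable D f -> measurable_fun D (f : R -> R).
Proof.
move=> mD [s [ss cs]]; apply: (@measurable_fun_cvg _ _ _ _ (s : nat -> R -> R)) => // n.
by apply: measurable_funTS; exact: simple_fun_measurable.
Qed.

Lemma ae_neq (c : R) : {ae mu, forall t : R, t != c}.
Proof.
have c0 : mu.-negligible [set c].
  by apply/negligibleP; [exact: measurable_set1|exact: lebesgue_measure_set1].
by apply: negligibleS c0 => t /= /negP; rewrite negbK => /eqP.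
Qed.

Lemma integrable_ae_bounded D (f : R -> R) (M : R) : measurable D -> (mu D < +oo)%E ->
  measurable_fun D f -> {ae mu, forall t, D t -> `|f t| <= M} ->
  mu.-integrable D (EFin \o f).
Proof.
move=> mD muD mf fM; apply/integrableP; split; first exact/measurable_EFinP.
apply: (@le_lt_trans _ _ (\int[mu]_(x in D) (`|M|)%:E)%E); last first.
  by rewrite integral_cst//= lte_mul_pinfty// ?lee_fin.
apply: ae_ge0_le_integral => //=.
- apply/measurable_EFinP; exact: measurableT_comp.
- move: fM; apply: (@filterS _ _ (ae_filter_ringOfSetsType mu)) => t ht Dt; rewrite lee_fin.
  by rewrite (le_trans (ht Dt))// ler_norm.
Qed.

Lemma Rintegral_cvg_bounded D (F : nat -> R -> R) (G : R -> R) (M : R) :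
  measurable D -> (mu D < +oo)%E ->
  (forall n, measurable_fun D (F n)) -> (forall n t, D t -> `|F n t| <= M) ->
  (forall t, D t -> F n t @[n --> \oo] --> G t) ->
  \int[mu]_(t in D) F n t @[n --> \oo] --> \int[mu]_(t in D) G t.
Proof.
move=> mD muD mF FM FG.
have mG : measurable_fun D G by exact: (measurable_fun_cvg mF).
have iM : mu.-integrable D (EFin \o cst M).
  by apply: (integrable_ae_bounded (M := `|M|)) => //; exact: aeW.
have GM t : D t -> `|G t| <= M.
  move=> Dt; have cG : `|F n t| @[n --> \oo] --> `|G t| by apply: cvg_norm; exact: FG.
  rewrite -(cvg_lim _ cG)//; apply: limr_le; first by apply/cvg_ex; eexists; exact: cG.
  by near=> n; exact: FM.
have iG : mu.-integrable D (EFin \o G).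
  by apply: (integrable_ae_bounded (M := M)) => //; exact: aeW.
have cv : ((\int[mu]_(x in D) (F n x)%:E)%E @[n --> \oo] --> (\int[mu]_(x in D) (G x)%:E)%E).
  apply: (@dominated_cvg _ _ _ mu D mD (fun n x => (F n x)%:E) (fun x => (G x)%:E)
    (EFin \o cst M)) => //.
  - by move=> n; apply/measurable_EFinP; exact: mF.
  - by move=> t Dt; apply/fine_cvgP; split; [exact: nearW|exact: FG].
apply: (@fine_cvg R nat \oo _ (fun n => (\int[mu]_(x in D) (F n x)%:E)%E)).
by rewrite fineK//; exact: integrable_fin_num iG.
Unshelve. all: by end_near. Qed.

Lemma Rintegral_ae_le D (g : R -> R) (M : R) : measurable D -> (mu D < +oo)%E ->
  measurable_fun D g ->
  {ae mu, forall t, D t -> `|g t| <= M} -> `|\int[mu]_(t in D) g t| <= `|M| * fine (mu D).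
Proof.
move=> mD muD mg gM; have ig := integrable_ae_bounded mD muD mg gM.
rewrite (le_trans (@le_normr_Rintegral _ _ _ mu D g mD ig))// -Rintegral_cst//.
have gM' : {ae mu, forall t, D t -> `|g t| <= `|M| }.
  move: gM; apply: (@filterS _ _ (ae_filter_ringOfSetsType mu)) => t h Dt.
  by rewrite (le_trans (h Dt))// ler_norm.
have ing : mu.-integrable D (EFin \o (fun t => `|g t|)).
  apply: (integrable_ae_bounded mD muD (M := `|M|)); first exact: measurableT_comp.
  by move: gM'; apply: (@filterS _ _ (ae_filter_ringOfSetsType mu)) => t h Dt; rewrite normr_id h.
have icst : mu.-integrable D (EFin \o cst `|M|).
  by apply: (integrable_ae_bounded mD muD (M := `|M|)) => //; apply: aeW => t Dt; rewrite normr_id.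
apply: fine_le; [exact: integrable_fin_num ing|exact: integrable_fin_num icst|].
apply: ae_ge0_le_integral => //=.
  by apply/measurable_EFinP; exact: measurableT_comp.
Qed.

End strong_measurability.

(** * Passing to the weak limit in the increment of the norm *)

Section weak_limit.
Context {R : realType} {E : normedModType R}.
Local Notation mu := (@lebesgue_measure R).
Hypothesis smooth : uniformly_smooth E.
Variable p : R.
Hypothesis p2 : 2 <= p.
Let p0 : 0 < p. Proof. by rewrite (lt_le_trans _ p2). Qed.
Variable D : set R.
Hypothesis mD : measurable D.
Hypothesis muD : (mu D < +oo)%E.

Lemma measurable_norm_powR (g : R -> E) : strongly_measurable D g ->
  measurable_fun D (fun t => `|g t| `^ p).
Proof.
move=> mg.
apply: (@strongly_measurable_real R D (fun t => `|g t| `^ p)) => //.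
apply: (@strongly_measurable_comp R D E R^o (fun v => `|v| `^ p) g) => // v.
exact: differentiable_continuous (differentiable_norm_powR smooth p2 v).
Qed.

Lemma measurable_duality_map (z y : R -> E) :
  strongly_measurable D z -> strongly_measurable D y ->
  measurable_fun D (fun t => duality_map p (z t) (y t)).
Proof.
move=> mz my; apply: (@measurable_fun_cvg _ _ _ _ (fun n t =>
   p^-1 * ((harmonic n)^-1 * (`|z t + (harmonic n : R) *: y t| `^ p - `|z t| `^ p)))) => [n|t Dt].
  apply: measurable_funM => //; apply: measurable_funM => //.
  apply: measurable_funB; last exact: measurable_norm_powR.
  apply: measurable_norm_powR; apply: strongly_measurableD => //.
  exact: strongly_measurableZ.
apply: cvgM; first exact: cvg_cst.
exact: (@diff_quotient_cvg _ _ (fun y => `|y| `^ p) _ _ (differentiable_norm_powR smooth p2 _)).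
Qed.

Variables (w : R -> E) (phi : R -> R) (W : R).
Hypothesis mw : strongly_measurable D w.
Hypothesis wW : forall t, D t -> `|w t| <= W.
Hypothesis mphi : measurable_fun D phi.
Hypothesis phi01 : forall t, `|phi t| <= 1.

(* The pairings with z = w / s are those whose limits smooth weak compactness controls. *)
Let increment (d : R -> E) t := (`|w t + d t| `^ p - `|w t| `^ p - `|d t| `^ p) * phi t.
Let mean_weight (N : nat) (k : nat) : R := (p / N.+1%:R) * (k.+1%:R / N.+1%:R) `^ (p - 1).
Let shift_duality (s : R) (d : R -> E) t :=
  (duality_map p (s^-1 *: w t + d t) (d t) - duality_map p (d t) (d t)) * phi t.

Let measurable_shift_duality s d : strongly_measurable D d ->
  measurable_fun D (shift_duality s d).
Proof.
move=> md; apply: measurable_funM => //; apply: measurable_funB; last exact: measurable_duality_map.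
apply: measurable_duality_map => //; apply: strongly_measurableD => //.
exact: strongly_measurableZ.
Qed.

Let measurable_increment d : strongly_measurable D d -> measurable_fun D (increment d).
Proof.
move=> md; apply: measurable_funM => //; apply: measurable_funB; last exact: measurable_norm_powR.
apply: measurable_funB; last exact: measurable_norm_powR.
by apply: measurable_norm_powR; exact: strongly_measurableD.
Qed.

Let integrable_shift_duality s d K : strongly_measurable D d -> ess_bounded D K d ->
  mu.-integrable D (EFin \o shift_duality s d).
Proof.
move=> md dK.
pose M := (`|s^-1| * W + K + K) `^ p + (K + K) `^ p.
apply: (integrable_ae_bounded mD muD (M := M)); first exact: measurable_shift_duality.
move: dK; apply: (@filterS _ _ (ae_filter_ringOfSetsType mu)) => t dK Dt; have {}dK := dK Dt.
rewrite /shift_duality normrM -[leRHS]mulr1 ler_pM// (le_trans (ler_normB _ _))//.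
have K0 : 0 <= K by rewrite (le_trans _ dK).
have W0 : 0 <= W by rewrite (le_trans _ (wW Dt)).
apply: lerD; rewrite (le_trans (duality_map_le smooth p2 _ _))// ge0_ler_powR//
  ?nnegrE ?(ltW p0)// ?addr_ge0 ?mulr_ge0 ?lerD//.
by rewrite (le_trans (ler_normD _ _))// lerD// normrZ ler_wpM2l// wW.
Qed.

Let integrable_increment d K : strongly_measurable D d -> ess_bounded D K d ->
  mu.-integrable D (EFin \o increment d).
Proof.
move=> md dK; pose M := (W + K) `^ p + W `^ p + K `^ p.
apply: (integrable_ae_bounded mD muD (M := M)); first exact: measurable_increment.
move: dK; apply: (@filterS _ _ (ae_filter_ringOfSetsType mu)) => t dK Dt; have {}dK := dK Dt.
have K0 : 0 <= K by rewrite (le_trans _ dK).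
have W0 : 0 <= W by rewrite (le_trans _ (wW Dt)).
rewrite /increment normrM -[leRHS]mulr1 ler_pM// (le_trans (ler_normB _ _))// lerD//.
  rewrite (le_trans (ler_normB _ _))// lerD// ger0_norm ?powR_ge0//
    ge0_ler_powR ?nnegrE ?(ltW p0) ?addr_ge0 ?wW//.
  by rewrite (le_trans (ler_normD _ _))// lerD// wW.
by rewrite ger0_norm ?powR_ge0// ge0_ler_powR ?nnegrE ?(ltW p0).
Qed.

Lemma increment_approx d K N : strongly_measurable D d -> ess_bounded D K d ->
  `| \sum_(k < N.+1) mean_weight N k *
        \int[mu]_(t in D) shift_duality (k.+1%:R / N.+1%:R) d t
     - \int[mu]_(t in D) increment d t |
  <= 2 * p * (W + 2 * K) `^ p * fine (mu D) / N.+1%:R.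
Proof.
move=> md dK.
have isd s := integrable_shift_duality s md dK.
have iinc := integrable_increment md dK.
pose S n t := \sum_(k < n) mean_weight N k * shift_duality (k.+1%:R / N.+1%:R) d t.
have iS n : mu.-integrable D (EFin \o S n) /\ \int[mu]_(t in D) S n t =
    \sum_(k < n) mean_weight N k * \int[mu]_(t in D) shift_duality (k.+1%:R / N.+1%:R) d t.
  elim: n => [|n [ih1 ih2]].
    have S0 : S 0%N = cst 0 by apply/funext => t; rewrite /S big_ord0.
    rewrite S0 big_ord0 Rintegral_cst// mul0r; split=> //; exact: integrable0.
  have SS : S n.+1 = fun t => S n t + mean_weight N n * shift_duality (n.+1%:R / N.+1%:R) d t.
    by apply/funext => t; rewrite /S big_ord_recr.
  have iZ : mu.-integrable D
      (EFin \o (fun t => mean_weight N n * shift_duality (n.+1%:R / N.+1%:R) d t)).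
    by have := @integrableZl _ _ _ mu D mD (mean_weight N n) _ (isd (n.+1%:R / N.+1%:R)).
  rewrite SS; split; first by have := @integrableD _ _ _ mu D mD _ _ ih1 iZ.
  by rewrite RintegralD// RintegralZl// ih2 big_ord_recr.
have [iSN <-] := iS N.+1; rewrite -RintegralB//.
set M := 2 * p * (W + 2 * K) `^ p.
have M0 : 0 <= M / N.+1%:R by rewrite divr_ge0 ?mulr_ge0 ?powR_ge0 ?(ltW p0).
rewrite mulrAC -(ger0_norm M0); apply: (Rintegral_ae_le mD muD).
  apply: measurable_funB; last exact: measurable_increment.
  by move/integrableP : iSN => [/measurable_EFinP].
move: dK; apply: (@filterS _ _ (ae_filter_ringOfSetsType mu)) => t dK Dt; have {}dK := dK Dt.
have -> : S N.+1 t - increment d t =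
  ((\sum_(k < N.+1) mean_weight N k * (duality_map p ((k.+1%:R / N.+1%:R)^-1 *: w t + d t) (d t)
      - duality_map p (d t) (d t))) -
   (`|w t + d t| `^ p - `|w t| `^ p - `|d t| `^ p)) * phi t.
  by rewrite mulrBl mulr_suml; congr (_ - _); apply: eq_bigr => k _; rewrite mulrA.
rewrite normrM -[leRHS]mulr1 ler_pM// (le_trans (riemann_duality_map smooth p2 _ _ _))//.
have K0 : 0 <= K by rewrite (le_trans _ dK).
have W0 : 0 <= W by rewrite (le_trans _ (wW Dt)).
rewrite ler_pM2r// ler_pM2l ?mulr_gt0// ge0_ler_powR ?nnegrE ?(ltW p0) ?addr_ge0 ?mulr_ge0//.
by rewrite lerD ?wW// ler_pM2l.
Qed.

Variables (d : nat -> R -> E) (y : R -> E) (K : R).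
Hypothesis md : forall n, strongly_measurable D (d n).
Hypothesis my : strongly_measurable D y.
Hypothesis dK : forall n, ess_bounded D K (d n).
Hypothesis yK : ess_bounded D K y.
Hypothesis cvg_duality : forall z : R -> E, Linfty_space D z ->
  \int[mu]_(t in D) ((duality_map p (z t + d n t) (d n t) - duality_map p (d n t) (d n t)) * phi t)
    @[n --> \oo] -->
  \int[mu]_(t in D) ((duality_map p (z t + y t) (y t) - duality_map p (y t) (y t)) * phi t).

(** The approximation of the increment of the norm by finite means is uniform in the
    sequence, so the limits in the sequence and in the mesh may be exchanged. *)
Lemma increment_cvg : \int[mu]_(t in D) increment (d n) t @[n --> \oo] -->
  \int[mu]_(t in D) increment y t.
Proof.
have cS (s : R) : \int[mu]_(t in D) shift_duality s (d n) t @[n --> \oo] -->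
    \int[mu]_(t in D) shift_duality s y t.
  apply: cvg_duality; split.
    exact: strongly_measurableZ.
  exists (`|s^-1| * W); apply: aeW => t Dt.
  by rewrite normrZ ler_wpM2l// wW.
have cSum N : (\sum_(k < N.+1) mean_weight N k *
        \int[mu]_(t in D) shift_duality (k.+1%:R / N.+1%:R) (d n) t) @[n --> \oo] -->
   \sum_(k < N.+1) mean_weight N k *
        \int[mu]_(t in D) shift_duality (k.+1%:R / N.+1%:R) y t.
  apply: cvg_big => [|k _].
    exact: (@add_continuous R^o).
  by apply: cvgM; [exact: cvg_cst|exact: cS].
apply/cvgrPdist_le => e e0.
set M := 2 * p * (W + 2 * K) `^ p * fine (mu D).
have M0 : 0 <= M by rewrite !mulr_ge0 ?powR_ge0 ?(ltW p0) ?fine_ge0.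
have e30 : 0 < e / 3 by rewrite divr_gt0.
have [N hN] : exists N, M / N.+1%:R <= e / 3.
  exists (Num.truncn (M / (e / 3))).
  rewrite ler_pdivrMr// mulrC -ler_pdivrMr//.
  exact/ltW/truncnS_gt.
have /cvgrPdist_le /(_ _ e30) := cSum N.
apply: filterS => n hn.
have h1 := increment_approx N (md n) (dK n).
have h2 := increment_approx N my yK.
move: hn (le_trans h1 hN) (le_trans h2 hN).
set A := \sum_(k < _) _; set A' := \sum_(k < _) _; set I1 := Rintegral _ _ _; set I2 := Rintegral _ _ _.
move: A A' I1 I2 => A A' I1 I2; rewrite !ler_norml => /andP[? ?] /andP[? ?] /andP[? ?]; apply/andP; split; lra.
Qed.

End weak_limit.

Section weak_limit_inequality.
Context {R : realType} {E : normedModType R}.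
Local Notation mu := (@lebesgue_measure R).

Lemma cvgn_ge0 (s : nat -> R) (l : R) :
  s n @[n --> \oo] --> l -> (forall n, 0 <= s n) -> 0 <= l.
Proof.
move=> sl s0; rewrite -(cvg_lim _ sl)//; apply: limr_ge; last exact: nearW.
by apply/cvg_ex; exists l.
Qed.

(** Only the test set A = D & {g < 0} matters: there the integrand is nonpositive with a
    nonnegative integral. *)
Lemma ae_ge0_of_Rintegral (D : set R) (g : R -> R) (M : R) : measurable D -> (mu D < +oo)%E ->
  measurable_fun D g -> {ae mu, forall t, D t -> `|g t| <= M} ->
  (forall A : set R, measurable A -> A `<=` D -> 0 <= \int[mu]_(t in D) (g t * \1_A t)) ->
  {ae mu, forall t, D t -> 0 <= g t}.
Proof.
move=> mD muD mg gM g0.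
pose A := D `&` [set t | g t < 0].
have mA : measurable A.
  rewrite /A (_ : [set t | _] = g @^-1` `]-oo, 0[).
    by apply: mg => //; exact: measurable_itv.
  by apply/seteqP; split=> t /=; rewrite in_itv.
have mgA : measurable_fun D (fun t => g t * \1_A t).
  by apply: measurable_funM => //; apply: measurable_funTS; exact: measurable_indic.
have igA : mu.-integrable D (EFin \o (fun t => g t * \1_A t)).
  apply: (integrable_ae_bounded mD muD (M := M)) => //.
  move: gM; apply: (@filterS _ _ (ae_filter_ringOfSetsType mu)) => t h Dt.
  rewrite normrM -[leRHS]mulr1 ler_pM ?h// indicE; case: (_ \in _); rewrite ?normr0// normr1//.
have gA0 t : D t -> g t * \1_A t <= 0.
  move=> Dt; rewrite indicE; case: (asboolP (A t)) => [At|nAt].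
    by rewrite mem_set// mulr1 ltW//; case: At.
  by rewrite memNset// mulr0.
have int0 : (\int[mu]_(t in D) `|(g t * \1_A t)%:E| = 0)%E.
  have -> : (\int[mu]_(t in D) `|(g t * \1_A t)%:E| = \int[mu]_(t in D) - (g t * \1_A t)%:E)%E.
    apply: eq_integral => t /set_mem Dt.
    by rewrite abse_EFin ler0_norm// gA0.
  have ik : mu.-integrable D (EFin \o (fun t => -1 * (g t * \1_A t))).
    exact: (@integrableZl _ _ _ mu D mD (-1) _ igA).
  have -> : (\int[mu]_(t in D) - (g t * \1_A t)%:E =
             \int[mu]_(t in D) (-1 * (g t * \1_A t))%:E)%E.
    by apply: eq_integral => t _; rewrite mulN1r.
  rewrite -[LHS](fineK (@integrable_fin_num _ _ _ mu D mD _ ik)); congr EFin.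
  rewrite -/(Rintegral mu D (fun t => -1 * (g t * \1_A t))).
  apply/eqP; rewrite eq_le; apply/andP; split.
    by rewrite (@RintegralZl _ _ _ mu)// mulN1r oppr_le0 g0//; exact: subIsetl.
  by apply: Rintegral_ge0 => t Dt; rewrite mulN1r oppr_ge0 gA0.
have : ae_eq mu D (EFin \o (fun t => g t * \1_A t)) (cst 0%E).
  by apply/ae_eq_integral_abs => //; exact/measurable_EFinP.
apply: (@filterS _ _ (ae_filter_ringOfSetsType mu)) => t h Dt.
have [//|gt0] := leP 0 (g t).
have At : A t by split.
have /= := h Dt; rewrite indicE mem_set// mulr1 => -[gE].
by rewrite gE ltxx in gt0.
Qed.

Hypothesis smooth : uniformly_smooth E.
Variable p : R.
Hypothesis p2 : 2 <= p.

(** The condition |d| <= |w + d| is not closed under weak limits of d in general.  It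
    survives here because the integrals of |w + d_n|^p - |d_n|^p over measurable sets
    converge, so that the lower bounds - e_n, which tend to 0, give in the limit a nonnegative
    integral over each measurable set. *)
Lemma norm_weak_limit_le (D : set R) (d : nat -> R -> E) (y w : R -> E) (e : nat -> R -> R)
    (K W M : R) : measurable D -> (mu D < +oo)%E ->
  (forall n, strongly_measurable D (d n)) -> (forall n, ess_bounded D K (d n)) ->
  strongly_measurable D y -> ess_bounded D K y ->
  strongly_measurable D w -> (forall t, D t -> `|w t| <= W) ->
  (forall z phi, Linfty_space D z -> mu.-integrable D (EFin \o phi) ->
    \int[mu]_(t in D) ((duality_map p (z t + d n t) (d n t)
                         - duality_map p (d n t) (d n t)) * phi t)
      @[n --> \oo] -->
    \int[mu]_(t in D) ((duality_map p (z t + y t) (y t) - duality_map p (y t) (y t)) * phi t)) ->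
  (forall n, measurable_fun D (e n)) -> (forall n t, D t -> `|e n t| <= M) ->
  (forall t, D t -> e n t @[n --> \oo] --> (0 : R)) ->
  (forall n t, D t -> `|d n t| `^ p <= `|w t + d n t| `^ p + e n t) ->
  {ae mu, forall t, D t -> `|y t| <= `|w t + y t|}.
Proof.
move=> mD muD md dK my yK mw wW cvg_d me eM e0 de.
have p0 : 0 < p by rewrite (lt_le_trans _ p2).
pose incr (v : R -> E) t := `|w t + v t| `^ p - `|w t| `^ p - `|v t| `^ p.
have mpow := measurable_norm_powR smooth p2 mD.
have bnd v : ess_bounded D K v ->
    {ae mu, forall t, D t -> `|incr v t| <= (W + K) `^ p + W `^ p + K `^ p}.
  apply: (@filterS _ _ (ae_filter_ringOfSetsType mu)) => t vK Dt; have {}vK := vK Dt.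
  have K0 : 0 <= K by rewrite (le_trans _ vK).
  have W0 : 0 <= W by rewrite (le_trans _ (wW _ Dt)).
  rewrite (le_trans (ler_normB _ _))// lerD//.
    rewrite (le_trans (ler_normB _ _))// lerD// ger0_norm ?powR_ge0//
      ge0_ler_powR ?nnegrE ?(ltW p0) ?addr_ge0 ?wW//.
    by rewrite (le_trans (ler_normD _ _))// lerD// wW.
  by rewrite ger0_norm ?powR_ge0// ge0_ler_powR ?nnegrE ?(ltW p0).
have mincr v : strongly_measurable D v -> measurable_fun D (incr v).
  move=> mv; apply: measurable_funB; last exact: mpow.
  by apply: measurable_funB; apply: mpow => //; exact: strongly_measurableD.
suff : {ae mu, forall t, D t -> 0 <= incr y t + `|w t| `^ p}.
  apply: (@filterS _ _ (ae_filter_ringOfSetsType mu)) => t h Dt.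
  have := h Dt; rewrite /incr => h1.
  have {}h1 : `|y t| `^ p <= `|w t + y t| `^ p by lra.
  rewrite leNgt; apply/negP => lt1.
  by have := gt0_ltr_powR p0 _ _ lt1; rewrite !nnegrE ltNge h1 => /(_ (normr_ge0 _) (normr_ge0 _)).
have wpW t : D t -> `| `|w t| `^ p | <= W `^ p.
  move=> Dt; rewrite ger0_norm ?powR_ge0// ge0_ler_powR ?nnegrE ?(ltW p0) ?wW//.
  by rewrite (le_trans _ (wW _ Dt)).
apply: (@ae_ge0_of_Rintegral D _ ((W + K) `^ p + W `^ p + K `^ p + W `^ p)) => //.
- by apply: measurable_funD; [exact: mincr|exact: mpow].
- move: (bnd _ yK); apply: (@filterS _ _ (ae_filter_ringOfSetsType mu)) => t h Dt.
  by rewrite (le_trans (ler_normD _ _))// lerD ?h ?wpW.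
move=> A mA AD.
have m1A : measurable_fun D (\1_A : R -> R).
  by apply: measurable_funTS; exact: measurable_indic.
have A01 t : `|\1_A t : R| <= 1.
  by rewrite indicE; case: (_ \in _); rewrite ?normr0 ?normr1.
have iA : mu.-integrable D (EFin \o (\1_A : R -> R)).
  by apply: (integrable_ae_bounded mD muD (M := 1)) => //; apply: aeW => t _; exact: A01.
have int_mulA (g : R -> R) (G : R) : measurable_fun D g -> {ae mu, forall t, D t -> `|g t| <= G} ->
    mu.-integrable D (EFin \o (fun t => g t * \1_A t)).
  move=> mg gG; apply: (integrable_ae_bounded mD muD (M := G)).
    exact: measurable_funM.
  move: gG; apply: (@filterS _ _ (ae_filter_ringOfSetsType mu)) => t h Dt.
  by rewrite normrM -[leRHS]mulr1 ler_pM ?h.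
have cI := increment_cvg smooth p2 mD muD mw wW m1A A01 md my dK yK (fun z hz => cvg_d z _ hz iA).
have iw := int_mulA _ _ (mpow _ mw) (aeW mu wpW).
have ie n := int_mulA _ _ (me n) (aeW mu (eM n)).
have iy := int_mulA _ _ (mincr _ my) (bnd _ yK).
have id_ n := int_mulA _ _ (mincr _ (md n)) (bnd _ (dK n)).
have -> : \int[mu]_(t in D) ((incr y t + `|w t| `^ p) * \1_A t) =
   \int[mu]_(t in D) (incr y t * \1_A t) + \int[mu]_(t in D) (`|w t| `^ p * \1_A t).
  rewrite -(@RintegralD _ _ _ mu)//; apply: eq_Rintegral => t _; exact: mulrDl.
have ce : \int[mu]_(t in D) (e n t * \1_A t) @[n --> \oo] --> (0 : R).
  rewrite -[X in _ --> X](_ : \int[mu]_(t in D) (0 : R) = 0); last by rewrite Rintegral_cst// mul0r.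
  apply: (Rintegral_cvg_bounded (M := M)) => //.
  - by move=> n; exact: measurable_funM.
  - by move=> n t Dt; rewrite normrM -[leRHS]mulr1 ler_pM ?eM.
  - move=> t Dt; rewrite -[X in _ --> X](mul0r (\1_A t)).
    by apply: cvgM; [exact: e0|exact: cvg_cst].
set P := \int[mu]_(t in D) (`|w t| `^ p * \1_A t).
have csum : \int[mu]_(t in D) (incr (d n) t * \1_A t) + P + \int[mu]_(t in D) (e n t * \1_A t)
   @[n --> \oo] --> \int[mu]_(t in D) (incr y t * \1_A t) + P.
  rewrite -[X in _ --> X]addr0; apply: cvgD => //; apply: cvgD; [exact: cI|exact: cvg_cst].
apply: (cvgn_ge0 csum) => n.
rewrite /P -(@RintegralD _ _ _ mu)//.
rewrite -(@RintegralD _ _ _ mu)//; last first.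
  exact: (@integrableD _ _ _ mu D mD _ _ (id_ n) iw).
apply: Rintegral_ge0 => t Dt.
rewrite -!mulrDl mulr_ge0 ?indicE//.
by have := de n t Dt; rewrite /incr; lra.
Qed.

End weak_limit_inequality.

(** * The catching-up scheme *)

Section catching_up.
Context {R : realType} {B : normedModType R}.
Implicit Types (C : set B) (f : B -> B).

Lemma dist_set_le C x c : C c -> dist_set x C <= `|x - c|.
Proof.
move=> Cc; apply: ge_inf; last by exists c.
by exists 0 => _ [y _ <-].
Qed.

(** With v the residual x + h f(x) - z, prox-regularity bounds the distance from z + r v / |v|
    to C from below by r.  The triangle inequality passes this bound down to all shorter
    multiples s v, which removes the normalization and the degenerate case v = 0. *)
Lemma prox_step (r h : R) f C x : prox_regular r f C -> 0 < r -> C x ->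
  0 < h -> h * `|f x| < r ->
  exists z, [/\ C z, `|x + h *: f x - z| <= h * `|f x| &
    forall s c, 0 < s -> s * `|x + h *: f x - z| <= r -> C c ->
      s * `|x + h *: f x - z| <= `|s *: (x + h *: f x - z) + (z - c)| ].
Proof.
move=> [_ prox] r0 Cx h0 hfr.
have [fx0|fx0] := eqVneq (f x) 0.
  exists x; rewrite fx0 scaler0 addr0 subrr normr0; split=> // [|s c _ _ _].
    by rewrite mulr0.
  by rewrite mulr0.
have nfx : 0 < `|f x| by rewrite normr_gt0.
have h0r : 0 < h * `|f x| < r by rewrite mulr_gt0.
have := prox x Cx _ h0r; rewrite /= /normalize scalerA mulfK ?gt_eqF//.
set y := x + h *: f x => -[z projz Gz].
have [Cz yzd] : projection C y z by rewrite projz.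
exists z; split=> // [|s c s0 sr Cc].
  by rewrite yzd (le_trans (dist_set_le _ Cx))// /y addrAC subrr add0r normrZ gtr0_norm.
have [->|yz0] := eqVneq (y - z) 0; first by rewrite normr0 mulr0.
have nyz : 0 < `|y - z| by rewrite normr_gt0.
have [_] := Gz; rewrite addrAC subrr add0r /normalize.
set n := `|y - z|^-1 *: (y - z).
have n1 : `|n| = 1 by rewrite normrZ normfV normr_id mulVf// gt_eqF.
rewrite normrZ n1 mulr1 gtr0_norm// => rE.
have := dist_set_le (z + r *: n) Cc; rewrite -rE => rle.
have -> : s *: (y - z) = (s * `|y - z|) *: n.
  by rewrite scalerA -mulrA mulfV ?mulr1 ?gt_eqF.
set sg := s * _ in sr *.
have zrc : z + r *: n - c = sg *: n + (z - c) + (r - sg) *: n.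
  rewrite scalerBl [RHS]addrAC [sg *: n + _]addrC subrK addrA.
  by rewrite [r *: n + z]addrC.
have := ler_normD (sg *: n + (z - c)) ((r - sg) *: n).
rewrite -zrc normrZ n1 mulr1 ger0_norm ?subr_ge0// => h1; lra.
Qed.

(** A run of N steps of U (k+1) = P_C (U k + h f (U k)), kept only through the bounds that the
    limit uses.  Here v is the discrete normal at U (k+1), and q = r / M turns the inequality
    of [prox_step] into one with the same constant for all v of norm at most M. *)
Definition discrete_solution (f : B -> B) C (u0 : B) (rho M q h : R) (N : nat) (U : nat -> B) :=
  U 0%N = u0 /\
  forall k, (k <= N)%N ->
    let v := f (U k) - h^-1 *: (U k.+1 - U k) in
    [/\ C (U k), `|U k| <= rho, `|f (U k)| <= M,
      `|U k.+1 - U k| <= 2 * M * h &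
      `|v| <= M /\ forall c, C c -> q * `|v| <= `|q *: v + (U k.+1 - c)| ].

(** Since U k lies in C, projecting moves U k + h f (U k) by at most h |f (U k)|, so a step
    has length at most 2 h L (1 + |U k|).  Hence 1 + |U k| grows at most by the
    factor 1 + 2 L h <= exp (2 L h) at each step, and stays below
    exp (2 L T) (1 + |u0|); this is where the constant M comes from. *)
Lemma discrete_solution_exists (r L T : R) f C u0 :
  prox_regular r f C -> 0 < r -> C u0 -> 0 < L -> 0 <= T ->
  (forall x, `|f x| <= L * (1 + `|x|)) ->
  let M := L * (expR (2 * L * T) * (1 + `|u0|)) in
  forall (h : R) N, 0 < h -> h * N%:R = T -> h * M < r ->
  exists U, discrete_solution f C u0 (M / L) M (r / M) h N U.
Proof.
move=> prox r0 Cu0 L0 T0 fL M h N h0 hN hM.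
have E0 (a : R) : 0 < expR a * (1 + `|u0|) by rewrite mulr_gt0 ?expR_gt0// ltr_pwDl.
have M0 : 0 < M by rewrite mulr_gt0.
pose good x z := C x -> h * `|f x| < r ->
  [/\ C z, `|x + h *: f x - z| <= h * `|f x| &
    forall s c, 0 < s -> s * `|x + h *: f x - z| <= r -> C c ->
      s * `|x + h *: f x - z| <= `|s *: (x + h *: f x - z) + (z - c)| ].
have /choice[stp hstp] : forall x, exists z, good x z.
  move=> x; have [Cx|nCx] := pselect (C x); last by exists x.
  have [hf|hf] := boolP (h * `|f x| < r); last by exists x => _ hf'; rewrite hf' in hf.
  by have [z zP] := prox_step prox r0 Cx h0 hf; exists z.
pose U k := iter k stp u0.
have fM x k : (k <= N)%N -> 1 + `|x| <= expR (2 * L * (h * k%:R)) * (1 + `|u0|) ->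
    `|f x| <= M.
  move=> kN hx; rewrite (le_trans (fL x))// ler_pM2l// (le_trans hx)//.
  rewrite ler_pM2r ?ltr_pwDl// ler_expR ler_pM2l ?mulr_gt0// -hN ler_pM2l//.
  by rewrite ler_nat.
have hfr x : `|f x| <= M -> h * `|f x| < r.
  by move=> fxM; rewrite (le_lt_trans _ hM)// ler_pM2l.
have dU x : C x -> `|f x| <= M -> `|stp x - x| <= 2 * (h * `|f x|).
  move=> Cx fxM; have [_ h1 _] := hstp x Cx (hfr _ fxM).
  have -> : stp x - x = h *: f x - (x + h *: f x - stp x).
    by rewrite opprB [RHS]addrC opprD addrA subrK.
  rewrite (le_trans (ler_normB _ _))// normrZ gtr0_norm//; lra.
have inv k : (k <= N)%N -> C (U k) /\ 1 + `|U k| <= expR (2 * L * (h * k%:R)) * (1 + `|u0|).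
  elim: k => [_|k ih kN]; first by rewrite !mulr0 expR0 mul1r.
  have [CU bU] := ih (ltnW kN).
  have fUM := fM _ _ (ltnW kN) bU.
  split; first by have [] := hstp _ CU (hfr _ fUM).
  have d1 := dU _ CU fUM.
  have -> : 2 * L * (h * k.+1%:R) = 2 * L * h + 2 * L * (h * k%:R).
    by rewrite -natr1; ring.
  rewrite expRD -mulrA.
  have e1 := expR_ge1Dx (2 * L * h).
  have tri : `|U k.+1| <= `|U k| + `|stp (U k) - U k|.
    by rewrite -{1}[U k.+1](subrK (U k)) addrC ler_normD.
  have fLU := fL (U k).
  have step1 : 1 + `|U k.+1| <= (1 + 2 * L * h) * (1 + `|U k|) by nra.
  rewrite (le_trans step1)// ler_pM ?addr_ge0 ?mulr_ge0 ?(ltW L0) ?(ltW h0)//.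
exists U; split=> // k kN /=.
have [CU bU] := inv k kN.
have fUM := fM _ _ kN bU.
have [CS dS nS] := hstp _ CU (hfr _ fUM).
have -> : f (U k) - h^-1 *: (stp (U k) - U k) = h^-1 *: (U k + h *: f (U k) - stp (U k)).
  rewrite [U k + _]addrC -addrA -[U k - _]opprB [RHS]scalerBr scalerA mulVf ?gt_eqF//.
  by rewrite scale1r.
rewrite -/(U k).
set v := U k + h *: f (U k) - stp (U k) in dS nS *.
have nv : `|h^-1 *: v| <= M.
  by rewrite normrZ normfV gtr0_norm// ler_pdivrMl// (le_trans dS)// ler_pM2l.
split=> //.
- rewrite /M mulrAC mulfV ?gt_eqF// mul1r.
  apply: (@le_trans _ _ (1 + `|U k|)); first by rewrite lerDr.
  rewrite (le_trans bU)// ler_pM2r ?ltr_pwDl// ler_expR ler_pM2l ?mulr_gt0// -hN ler_pM2l//.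
  by rewrite ler_nat.
- by rewrite (le_trans (dU _ CU fUM))// -mulrA ler_pM2l// mulrC ler_pM2r.
split=> // c Cc.
have e1 : r / M / h * `|v| = r / M * `|h^-1 *: v|.
  by rewrite normrZ normfV gtr0_norm// mulrA.
have := nS (r / M / h) c; rewrite e1 -[(r / M / h) *: v]scalerA; apply=> //.
  by rewrite !divr_gt0.
by rewrite mulrAC ler_pdivrMr// ler_pM2l.
Qed.

End catching_up.

(** * Step functions on a uniform subdivision *)

Section step_functions.
Context {R : realType}.
Local Notation mu := (@lebesgue_measure R).
Variables (h : R) (N : nat).
Hypothesis h0 : 0 < h.

(** The index k <= N of the cell [k h, (k+1) h[ that contains a time in [0, N h],
    written as a sum so that functions of it are visibly simple. *)
Definition cell (t : R) : nat := \sum_(j < N) ((j.+1%:R * h <= t)%R : nat).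

Lemma cell_le t : (cell t <= N)%N.
Proof.
rewrite /cell -[X in (_ <= X)%N]card_ord -sum1_card; apply: leq_sum => j _.
by case: (_ <= _).
Qed.

Lemma cellE t k : (k <= N)%N -> k%:R * h <= t -> t < k.+1%:R * h -> cell t = k.
Proof.
move=> kN kt tk.
have -> : cell t = \sum_(j < N) ((j < k)%N : nat).
  apply: eq_bigr => j _; congr (nat_of_bool _); apply/idP/idP => [jt|jk].
    have := le_lt_trans jt tk; rewrite ltr_pM2r// ltr_nat ltnS //.
  by rewrite (le_trans _ kt)// ler_pM2r// ler_nat.
have sumE n : (\sum_(j < n) ((j < k)%N : nat) = minn k n)%N.
  elim: n => [|n ih]; first by rewrite big_ord0 minn0.
  rewrite big_ord_recr /= ih; case: (boolP (n < k)%N) => nk.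
    by rewrite (minn_idPr (ltnW nk)) (minn_idPr nk) addn1.
  rewrite -leqNgt in nk.
  by rewrite (minn_idPl nk) addn0 (minn_idPl (leqW nk)).
by rewrite sumE; apply/minn_idPl.
Qed.

Lemma cell_itv t : 0 <= t <= N%:R * h -> (cell t)%:R * h <= t < (cell t).+1%:R * h.
Proof.
move=> /andP[t0 tN].
have th0 : 0 <= t / h by rewrite divr_ge0// ltW.
have lb : (Num.truncn (t / h))%:R * h <= t.
  by rewrite -ler_pdivlMr// truncn_le.
have ub : t < (Num.truncn (t / h)).+1%:R * h by rewrite -ltr_pdivrMr// truncnS_gt.
suff -> : cell t = Num.truncn (t / h) by rewrite lb ub.
apply: cellE => //; rewrite -(ler_nat R) -(ler_pM2r h0).
exact: le_trans lb tN.
Qed.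

Lemma simple_fun_cell (V : normedModType R) (g : nat -> V) : simple_fun (g \o cell).
Proof.
have half (a : R) : simple_fun (fun t => ((a <= t)%R : nat)%:R : R^o).
  have -> : (fun t => ((a <= t)%R : nat)%:R) = \1_(`[a, +oo[%classic) :> (R -> R).
    by apply/funext => t; rewrite indicE mem_setE in_itv/= andbT.
  by apply: simple_fun_indic; exact: measurable_itv.
have cnt n : simple_fun (fun t => (\sum_(j < n) ((j.+1%:R * h <= t)%R : nat))%:R : R^o).
  elim: n => [|n ih].
    by under eq_fun do rewrite big_ord0; exact: simple_fun_cst.
  under eq_fun do rewrite big_ord_recr /= natrD.
  exact: (simple_fun_comp2 (fun a b : R^o => a + b) ih (half _)).
have := simple_fun_comp2 (fun (a _ : R^o) => g (Num.truncn (a : R))) (cnt N) (cnt N).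
by under eq_fun do rewrite natrK.
Qed.

Lemma Rintegral_cell (g : nat -> R) (s : R) : 0 <= s <= N%:R * h ->
  \int[mu]_(t in `[0, s[) g (cell t) =
  h * \sum_(j < cell s) g j + (s - (cell s)%:R * h) * g (cell s).
Proof.
move=> sN; have /andP[cs sc] := cell_itv sN.
have mg : measurable_fun setT (g \o cell) by exact: simple_fun_measurable (@simple_fun_cell R^o g).
have ig (a b : R) : mu.-integrable `[a, b[ (EFin \o (g \o cell)).
  apply: (integrable_ae_bounded (M := \sum_(j < N.+1) `|g j|)) => //.
  - by rewrite lebesgue_measure_itv/=; case: ifP => // _; rewrite -EFinD ltry.
  - exact: measurable_funTS.
  - apply: aeW => t _ /=; have := cell_le t; rewrite -ltnS => ct.
    by rewrite (bigD1 (Ordinal ct))//= lerDl sumr_ge0.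
have icell a b k : (k <= N)%N -> k%:R * h <= a -> a <= b -> b <= k.+1%:R * h ->
    \int[mu]_(t in `[a, b[) g (cell t) = (b - a) * g k.
  move=> kN ka ab bk; rewrite (@eq_Rintegral _ _ _ mu _ (cst (g k))); last first.
    move=> t; rewrite inE/= in_itv/= => /andP[at_ tb].
    by rewrite (@cellE t k)// ?(le_trans ka)// (lt_le_trans tb).
  have -> : \int[mu]_(t in `[a, b[) cst (g k) t = g k * fine (mu `[a, b[%classic).
    exact: Rintegral_cst.
  rewrite lebesgue_measure_itv/= lte_fin mulrC.
  by have [->|ab'] := eqVneq a b; rewrite ?ltxx ?subrr// lt_neqAle ab' ab.
have split a b : 0 <= a -> a <= b -> \int[mu]_(t in `[0, b[) g (cell t) =
   \int[mu]_(t in `[0, a[) g (cell t) + \int[mu]_(t in `[a, b[) g (cell t).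
  move=> a0 ab.
  have -> : `[0, b[%classic = `[0, a[ `|` `[a, b[ :> set R.
    by rewrite -itv_bndbnd_setU.
  rewrite (@Rintegral_setU _ _ _ mu)//; first by rewrite -itv_bndbnd_setU//; exact: ig.
  apply/disj_setPS => t [/=]; rewrite !in_itv/= => /andP[_ ta] /andP[].
  by rewrite leNgt ta.
have full k : (k <= N)%N -> \int[mu]_(t in `[0, k%:R * h[) g (cell t) = h * \sum_(j < k) g j.
  elim: k => [_|k ih kN]; first by rewrite mul0r set_itvco0 Rintegral_set0 big_ord0 mulr0.
  have kh : k%:R * h <= k.+1%:R * h by rewrite ler_pM2r// ler_nat.
  rewrite (split (k%:R * h))// ?mulr_ge0 ?(ltW h0)// ih ?(ltnW kN)//.
  rewrite (icell _ _ k) ?(ltnW kN)// big_ord_recr/= mulrDr; congr (_ + _ * _).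
  by rewrite -mulrBl -natr1 addrAC subrr add0r mul1r.
rewrite (split ((cell s)%:R * h))// ?mulr_ge0 ?(ltW h0)//.
by rewrite full ?cell_le// (icell _ _ (cell s)) ?cell_le// ltW.
Qed.

End step_functions.

(** * Weak primitives of strongly measurable functions *)

Section weak_to_strong.
Context {R : realType} {E : normedModType R}.
Local Notation mu := (@lebesgue_measure R).

Definition contractive (phi : dual_space E) := forall v, `|phi v| <= `|v|.

Lemma dualB (phi : dual_space E) x y : phi (x - y) = (phi x : R) - phi y.
Proof.
have := dual_linear phi (-1) y x; rewrite !scaleN1r.
by rewrite [- y + x]addrC [X in _ = X -> _]addrC.
Qed.

Lemma dualZ (phi : dual_space E) (a : R) x : phi (a *: x) = a * (phi x : R).
Proof.
have p0 : phi 0 = 0 by have := dualB phi 0 0; rewrite subrr => ->; rewrite subrr.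
by have := dual_linear phi a x 0; rewrite addr0 p0 addr0.
Qed.

Hypothesis smooth : uniformly_smooth E.

Lemma contractive_norming x : exists2 phi, contractive phi & phi x = `|x|.
Proof. by have [phi [? ?]] := norming_functional smooth x; exists phi. Qed.

(** Two cluster points of u have the same image under the functional that norms their
    difference, hence coincide; in a compact set a single cluster point is a limit. *)
Lemma compact_weak_cvg (K : set E) (u : nat -> E) : compact K -> (forall n, K (u n)) ->
  (forall phi, contractive phi -> exists a : R, phi (u n) @[n --> \oo] --> a) ->
  exists l : E, u @ \oo --> l.
Proof.
move=> cK Ku cphi.
have cluster_val phi (a : R) (G : set_system nat) x : Filter G -> contractive phi ->
    phi (u n) @[n --> \oo] --> a -> \oo `<=` G -> cluster (u @ G) x -> phi x = a.
  move=> FG cphi1 ca GG clx; apply/eqP; rewrite -subr_eq0 -normr_le0.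
  apply/ler_addgt0Pr => /= e e0; rewrite add0r.
  have e20 : 0 < e / 2 by rewrite divr_gt0.
  have /cvgrPdist_lt/(_ _ e20)/GG Ga := ca.
  have [z []] := clx [set z | `|a - phi z| < e / 2] (ball x (e / 2)) Ga (nbhsx_ballx _ _ e20).
  rewrite /= => az; rewrite -ball_normE /= => xz.
  have := cphi1 (x - z); rewrite dualB => h1.
  have -> : (phi x : R) - a = (phi x - phi z) - (a - phi z) by ring.
  by rewrite (le_trans (ler_normB _ _))// (splitr e) lerD// ?(le_trans h1)// ltW.
have [l [Kl cl]] : K `&` cluster (u @ \oo) !=set0.
  by apply: cK; apply: (@filterE nat \oo) => n; exact: Ku.
exists l; apply/cvgrPdist_lt => e e0; apply: contrapT => nh.
pose P := [set n | e <= `|l - u n|].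
have FP : Filter (within P \oo) by exact: within_filter.
have PP : ProperFilter (within P \oo).
  split => //; rewrite /within /= => h0; apply: nh; apply: filterS h0 => n Pn.
  by rewrite ltNge; apply/negP => /Pn.
have [l' [Kl' cl']] : K `&` cluster (u @ within P \oo) !=set0.
  by apply: cK; apply: (@filterE nat (within P \oo)) => n; exact: Ku.
have [phi cphi1 phiE] := contractive_norming (l' - l).
have [a ca] := cphi _ cphi1.
have phil := cluster_val phi a _ l _ cphi1 ca (fun A => id) cl.
have phil' := cluster_val phi a _ l' FP cphi1 ca (@cvg_within _ _ _ _) cl'.
have ll' : l' = l.
  by apply/eqP; rewrite -subr_eq0 -normr_eq0 -phiE dualB phil phil' subrr.
have Pu : (u @ within P \oo) [set z | e <= `|l - z|].
  by rewrite /fmap /within /=; exact: nearW.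
have [z []] := cl' _ _ Pu (nbhsx_ballx l' _ e0).
by rewrite /= -ball_normE /= ll' => /le_lt_trans h /h; rewrite ltxx.
Qed.

Lemma dense_sequence : separable_space E -> exists v : nat -> E,
  forall x (e : R), 0 < e -> exists n, `|x - v n| < e.
Proof.
move=> [A cA dA].
have A0 : A !=set0.
  have [|a [_ Aa]] := dA setT _ openT; last by exists a.
  by exists 0.
have /pfcard_geP[A00|/unsquash s] := cA; first by case: A0 => a; rewrite A00.
exists (fun n => s n) => x e e0.
have [|a [xa Aa]] := dA (ball x e) _ (ball_open x e); first by exists x; exact: ballxx.
have [n _ sn] := @surj _ _ _ _ s a Aa.
by exists n; rewrite sn; move: xa; rewrite -ball_normE.
Qed.

Section primitive.
Variables (T K : R) (u g : R -> E).
Local Notation D := `[(0 : R), T]%classic.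
Hypothesis mg : strongly_measurable D g.
Hypothesis gK : ess_bounded D K g.
Hypothesis ug : forall phi (s : R), contractive phi -> 0 <= s <= T ->
  phi (u s) = (phi (u 0) : R) + \int[mu]_(t in `[0, s[) phi (g t).

Let mD : measurable D. Proof. exact: measurable_itv. Qed.
Let muD : (mu D < +oo)%E.
Proof. by rewrite lebesgue_measure_itv/=; case: ifP => // _; rewrite -EFinD ltry. Qed.

Let integrable_dist v : mu.-integrable D (EFin \o (fun t => `|g t - v|)).
Proof.
apply: (integrable_ae_bounded mD muD (M := K + `|v|)).
  apply: (@strongly_measurable_real R D (fun t => `|g t - v|)) => //.
  apply: (@strongly_measurable_comp R D E R^o (fun x => `|x - v|) g) => // x.
  by apply: cvg_norm; apply: cvgB; [exact: cvg_id|exact: cvg_cst].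
move: gK; apply: (@filterS _ _ (ae_filter_ringOfSetsType mu)) => t h Dt.
by rewrite normr_id (le_trans (ler_normB _ _))// lerD// h.
Qed.

(** The function u is a primitive of g only when tested against norming functionals.  Choosing
    the functional that norms u b - u a - (b - a) v recovers an estimate in norm
    without integrating vector-valued functions. *)
Lemma primitive_dist v a b : 0 <= a -> a <= b -> b <= T ->
  `|u b - u a - (b - a) *: v| <= \int[mu]_(t in `[a, b]) `|g t - v|.
Proof.
move=> a0 ab bT; have [phi cphi <-] := contractive_norming (u b - u a - (b - a) *: v).
have b0 := le_trans a0 ab; have aT := le_trans ab bT.
have sub c d : 0 <= c -> d <= T -> `[c, d[ `<=` D.
  move=> c0 dT t; rewrite /= !in_itv/= => /andP[ct td].
  by rewrite (le_trans c0 ct) (le_trans (ltW td) dT).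
have mphi : measurable_fun D (fun t => phi (g t) : R).
  apply: (@strongly_measurable_real R D (fun t => phi (g t))) => //.
  apply: (@strongly_measurable_comp R D E R^o phi g) => //.
  exact: dual_continuous.
have iphi : mu.-integrable D (EFin \o (fun t => phi (g t) : R)).
  apply: (integrable_ae_bounded mD muD (M := K)) => //.
  move: gK; apply: (@filterS _ _ (ae_filter_ringOfSetsType mu)) => t h Dt.
  by rewrite (le_trans (cphi _))// h.
have icst (c : R) : mu.-integrable D (EFin \o (fun _ : R => c)).
  by apply: (integrable_ae_bounded mD muD (M := `|c|)) => //; exact: aeW.
have iab (F : R -> R) c d : 0 <= c -> d <= T -> mu.-integrable D (EFin \o F) ->
    mu.-integrable `[c, d[ (EFin \o F).
  by move=> c0 dT; apply: integrableS => //; exact: sub.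
have -> : (phi (u b - u a - (b - a) *: v) : R) = \int[mu]_(t in `[a, b[) (phi (g t) - phi v : R).
  rewrite !dualB dualZ (ug cphi (s := b)) ?b0// (ug cphi (s := a)) ?a0//.
  have -> : \int[mu]_(t in `[0, b[) (phi (g t) : R) =
     \int[mu]_(t in `[0, a[) (phi (g t) : R) + \int[mu]_(t in `[a, b[) (phi (g t) : R).
    have -> : `[0, b[%classic = `[0, a[ `|` `[a, b[ :> set R.
      by rewrite -itv_bndbnd_setU.
    rewrite (@Rintegral_setU _ _ _ mu)//; first by rewrite -itv_bndbnd_setU//; exact: iab.
    apply/disj_setPS => t [/=]; rewrite !in_itv/= => /andP[_ ta] /andP[].
    by rewrite leNgt ta.
  rewrite (@RintegralB _ _ _ mu)//; [|exact: iab..].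
  have -> : \int[mu]_(t in `[a, b[) (phi v : R) = phi v * fine (mu `[a, b[%classic).
    exact: Rintegral_cst.
  rewrite lebesgue_measure_itv/= lte_fin.
  have -> : fine (if a < b then (b%:E - a%:E)%E else 0%E) = b - a.
    by have [->|ab'] := eqVneq a b; rewrite ?ltxx ?subrr// lt_neqAle ab' ab.
  by ring.
have idist := iab _ _ _ a0 bT (integrable_dist v).
rewrite -Rintegral_itv_bndo_bndc//; apply: (@le_Rintegral _ _ _ mu) => //.
  by have := @integrableB _ _ _ mu _ _ _ _ (iab _ _ _ a0 bT iphi) (iab _ _ _ a0 bT (icst (phi v))); exact.
move=> t _; rewrite -dualB (le_trans (ler_norm _))//; exact: cphi.
Qed.

Lemma primitive_lipschitz a b : 0 <= a -> a <= b -> b <= T ->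
  `|u b - u a| <= `|K| * (b - a).
Proof.
move=> a0 ab bT; have := primitive_dist 0 a0 ab bT; rewrite scaler0 subr0 => /le_trans; apply.
have abD : `[a, b] `<=` D.
  move=> t; rewrite /= !in_itv/= => /andP[at_ tb].
  by rewrite (le_trans a0 at_) (le_trans tb bT).
have muab : mu `[a, b]%classic = (b - a)%:E.
  rewrite lebesgue_measure_itv/= lte_fin.
  by have [->|ab'] := eqVneq a b; rewrite ?ltxx ?subrr// lt_neqAle ab' ab.
apply: (le_trans (ler_norm _)); have -> : b - a = fine (mu `[a, b]%classic) by rewrite muab.
apply: Rintegral_ae_le => //; first by rewrite muab ltry.
  have /integrableP[/measurable_EFinP mdist _] := integrable_dist 0.
  exact: measurable_funS mdist.
move: gK; apply: (@filterS _ _ (ae_filter_ringOfSetsType mu)) => t h /abD Dt.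
by rewrite subr0 normr_id h.
Qed.

(** At almost every t, the scalar functions |g - v_n|, with (v_n) dense, are all derivatives
    of their integrals.  By [primitive_dist] the difference quotients of u at t are then
    eventually within |g t - v_n| + e of v_n, for each n; v_n close to g t concludes. *)
Lemma primitive_derivable : separable_space E ->
  {ae mu, forall t, D t -> derivable u t 1 /\ derive1 u t = g t}.
Proof.
move=> /dense_sequence[v vdense].
pose k n : R -> R := (fun t => `|g t - v n|) \_ D.
pose F n (x : R) := \int[mu]_(t in `]-oo, x]) k n t.
have ik n (A : set R) : measurable A -> mu.-integrable A (EFin \o k n).
  move=> mA; apply: (@integrableS _ _ _ mu setT) => //.
  by have := (@integrable_mkcond _ _ _ mu D _ mD).1 (integrable_dist (v n)); rewrite restrict_EFin.
have Fk n : {ae mu, forall x, derivable (F n) x 1 /\ derive1 (F n) x = k n x}.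
  apply: FTC1Ny => [y|]; first by apply: ik; exact: measurable_itv.
  by apply: integrable_locally => //; exact: integrable_dist.
move: (@ae_foralln _ _ _ mu _ Fk) (@ae_neq R 0) (@ae_neq R T).
apply: (@filterS3 _ _ (ae_filter_ringOfSetsType mu)) => t Fkt t0 tT Dt.
have {t0 tT} /andP[t0 tT] : 0 < t < T.
  by move: Dt; rewrite /= in_itv/= !lt_neqAle (eq_sym 0) t0 tT.
have dF n a b : 0 <= a -> a <= b -> b <= T -> `|u b - u a - (b - a) *: v n| <= F n b - F n a.
  move=> a0 ab bT; rewrite /F Rintegral_itvB ?bnd_simp//; last exact: ik.
  rewrite Rintegral_itv_obnd_cbnd; last by apply: ik; exact: measurable_itv.
  rewrite (le_trans (primitive_dist (v n) a0 ab bT))// le_eqVlt; apply/orP; left; apply/eqP.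
  apply: eq_Rintegral => s; rewrite inE/= in_itv/= => /andP[as_ sb].
  by rewrite /k patchE mem_set//= in_itv/= (le_trans a0 as_) (le_trans sb bT).
have quot : (fun h : R => h^-1 *: (u (h + t) - u t)) @ 0^' --> g t.
  apply/cvgrPdist_le => e e0.
  have e30 : 0 < e / 3 by rewrite divr_gt0.
  have [n gn] := vdense (g t) _ e30.
  have [dFn F'n] := Fkt n.
  have cF : (fun h : R => h^-1 *: (F n (h + t) - F n t)) @ 0^' --> `|g t - v n|.
    have -> : `|g t - v n| = derive1 (F n) t by rewrite F'n /k patchE mem_set.
    by rewrite derive1E; move: dFn; rewrite /derivable /derive /=; under eq_fun do rewrite [_%:A]mulr1.
  have /cvgrPdist_lt/(_ _ e30) hF := cF.
  near=> h.
  have h0 : h != 0 by near: h; exact: nbhs_dnbhs_neq.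
  have hpos : `|h| < Num.min t (T - t).
    near: h; apply: dnbhs0_lt; by rewrite lt_min t0 subr_gt0.
  have hFh : `| `|g t - v n| - h^-1 *: (F n (h + t) - F n t)| < e / 3 by near: h.
  have ht0 : 0 <= h + t /\ h + t <= T.
    move: hpos; rewrite lt_min => /andP[]; rewrite !ltr_norml => /andP[? ?] /andP[? ?].
    by split; lra.
  have qF : `|h^-1 *: (u (h + t) - u t) - v n| <= h^-1 *: (F n (h + t) - F n t).
    have -> : h^-1 *: (u (h + t) - u t) - v n = h^-1 *: (u (h + t) - u t - h *: v n).
      by rewrite [RHS]scalerBr scalerA mulVf// scale1r.
    have [hlt|hgt|h00] := ltgtP h 0; last by rewrite h00 eqxx in h0.
    - have := dF n (h + t) t ht0.1 _ (ltW tT).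
      have -> : t - (h + t) = - h by ring.
      have -> : u t - u (h + t) - (- h) *: v n = - (u (h + t) - u t - h *: v n).
        by rewrite scaleNr opprK !opprB [RHS]addrC.
      rewrite normrN => hd.
      have -> : h^-1 *: (F n (h + t) - F n t) = (- h)^-1 * (F n t - F n (h + t)).
        by rewrite invrN mulNr -mulrN opprB.
      rewrite normrZ normfV ltr0_norm// ler_pM2l ?invr_gt0 ?oppr_gt0//.
      by apply: hd; lra.
    - have := dF n t (h + t) (ltW t0) _ ht0.2.
      rewrite addrK => /(_ ltac:(lra)) hd.
      rewrite normrZ gtr0_norm ?invr_gt0//. 
      by rewrite ler_pM2l ?invr_gt0.
  have tri : `|g t - h^-1 *: (u (h + t) - u t)| <=
      `|g t - v n| + `|h^-1 *: (u (h + t) - u t) - v n|.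
    by rewrite [X in _ <= _ + X]distrC ler_distD.
  by move: hFh; rewrite ltr_norml => /andP[? ?]; lra.
have dq : derivable u t 1.
  apply/cvg_ex; exists (g t); move: quot.
  by under eq_fun do rewrite -[h in u (h + t)]mulr1.
by split=> //; apply/cvg_lim.
Unshelve. all: by end_near. Qed.

End primitive.
End weak_to_strong.

(** * Subsequences, dense sequences and test functions *)

Section assembly.
Context {R : realType} {B : normedModType R}.
Local Notation mu := (@lebesgue_measure R).

Lemma increasing_cvg_infty (k : nat -> nat) : {homo k : i j / (i < j)%N} -> k @ \oo --> \oo.
Proof.
move=> kinc; have kn n : (n <= k n)%N.
  by elim: n => // n ih; exact: leq_ltn_trans ih (kinc _ _ (ltnSn n)).
move=> A [N _ NA]; exists N => // n /= Nn; apply: NA => /=.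
exact: leq_trans Nn (kn n).
Qed.

(** One point of C is chosen in each ball of radius 1 / (j + 1) around a dense sequence that
    meets C. *)
Lemma dense_sequence_in (C : set B) (x0 : B) : separable_space B -> C x0 ->
  exists c : nat -> nat -> B, (forall i j, C (c i j)) /\
    forall x (e : R), C x -> 0 < e -> exists i j, `|x - c i j| < e.
Proof.
move=> sepB Cx0; have [v hv] := dense_sequence sepB.
pose near_v (ij : nat * nat) y := C y /\
  ((exists2 x, C x & `|x - v ij.1| < ij.2.+1%:R^-1) -> `|y - v ij.1| < ij.2.+1%:R^-1).
have /choice[c hc] : forall ij, exists y, near_v ij y.
  move=> ij; have [[x Cx xv]|nx] := pselect (exists2 x, C x & `|x - v ij.1| < ij.2.+1%:R^-1).
    by exists x; split.
  by exists x0; split.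
exists (fun i j => c (i, j)); split; first by move=> i j; have [] := hc (i, j).
move=> x e Cx e0.
have e20 : 0 < e / 2 by rewrite divr_gt0.
have [j hj] : exists j : nat, (j.+1%:R^-1 : R) < e / 2.
  exists (Num.truncn (e / 2)^-1).
  by rewrite -[ltRHS]invrK ltf_pV2 ?posrE ?invr_gt0// truncnS_gt.
have [i hi] := hv x j.+1%:R^-1 ltac:(by rewrite invr_gt0).
exists i, j; have [_ /(_ (ex_intro2 _ _ x Cx hi)) /= hcv] := hc (i, j).
rewrite (le_lt_trans (ler_distD (v i) _ _))// (splitr e) ltrD// ?(lt_trans hi)//.
by rewrite distrC (lt_trans hcv).
Qed.

(** The test function is t |-> 1_[0, s[(t) phi, a simple function with values in the dual. *)
Lemma Linfty_weak_cvg_itv (T : R) (x : nat -> R -> B) (y : R -> B) phi (s : R) :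
  Linfty_weak_cvg `[0, T] x y -> 0 <= s <= T ->
  \int[mu]_(t in `[0, s[) (phi : dual_space B) (x n t) @[n --> \oo] -->
  \int[mu]_(t in `[0, s[) phi (y t).
Proof.
move=> wxy /andP[s0 sT].
pose P := `[0, s[%classic : set R; pose D := `[0, T]%classic : set R.
have mP : measurable P by exact: measurable_itv.
have mD : measurable D by exact: measurable_itv.
have muD : (mu D < +oo)%E.
  by rewrite lebesgue_measure_itv/=; case: ifP => // _; rewrite -EFinD ltry.
pose g (t : R) : dual_space B := (\1_P t : R) *: phi.
have gE t v : g t v = ((fun t => phi v) \_ P) t.
  rewrite /g -[LHS]/((\1_P t : R) * phi v) patchE indicE.
  by case: (_ \in _); rewrite ?mul1r ?mul0r.
have sg : simple_fun g.
  exact: (simple_fun_comp2 (fun (a _ : R^o) => a *: phi) (simple_fun_indic mP)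
    (simple_fun_indic mP)).
have smg : strongly_measurable D g.
  by exists (fun _ => g); split=> // t _; exact: cvg_cst.
have L1g : L1_space D g.
  split=> //; apply: (integrable_ae_bounded mD muD (M := `|phi|)).
    apply: (@strongly_measurable_real R D (fun t => `|g t|)) => //.
    by apply: (@strongly_measurable_comp R D _ R^o (fun x => `|x|) g) => // v; exact: norm_continuous.
  apply: aeW => t _; rewrite normr_id /g normrZ indicE.
  by case: (_ \in _); rewrite ?normr1 ?normr0 ?mul1r ?mul0r.
have DP : `[0, s[%classic = D `&` P.
  by apply/esym/setIidPr => t; rewrite /P/D/= !in_itv/= => /andP[-> /ltW/le_trans]; exact.
have := wxy g L1g.
have intE (z : R -> B) : \int[mu]_(t in D) g t (z t) = \int[mu]_(t in `[0, s[) phi (z t).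
  rewrite [in RHS]DP Rintegral_mkcondr; apply: eq_Rintegral => t _.
  by rewrite gE !patchE.
by under eq_fun do rewrite intE; rewrite intE.
Qed.

End assembly.

(** * The limit of the scheme *)

Section interpolation.
Context {R : realType} {B : normedModType R}.
Local Notation mu := (@lebesgue_measure R).
Variables (f : B -> B) (C : set B) (u0 : B) (rho M q : R).

(** The scheme as step functions of time: [next_position] is needed because the discrete
    normal on a cell is normal to C at the end of the step. *)
Definition position (h : R) (N : nat) (U : nat -> B) (t : R) : B := U (cell h N t).

Definition next_position (h : R) (N : nat) (U : nat -> B) (t : R) : B :=
  U (cell h N t).+1.

Definition velocity (h : R) (N : nat) (U : nat -> B) (t : R) : B :=
  h^-1 *: (next_position h N U t - position h N U t).

Definition normal_part (h : R) (N : nat) (U : nat -> B) (t : R) : B :=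
  f (position h N U t) - velocity h N U t.

Lemma discrete_solution_cell (h : R) (N : nat) (U : nat -> B) (t : R) :
  0 < h -> discrete_solution f C u0 rho M q h N U ->
  [/\ C (position h N U t) /\ `|position h N U t| <= rho,
      `|f (position h N U t)| <= M,
      `|next_position h N U t - position h N U t| <= 2 * M * h,
      `|velocity h N U t| <= 2 * M &
      `|normal_part h N U t| <= M /\ forall c, C c ->
        q * `|normal_part h N U t| <= `|q *: normal_part h N U t + (next_position h N U t - c)| ].
Proof.
move=> h0 [_ /(_ _ (cell_le h N t))[CU Ur fM dU [nM nq]]]; split=> //.
by rewrite /velocity normrZ normfV gtr0_norm// ler_pdivrMl// mulrC.
Qed.

Lemma strongly_measurable_cell (V : normedModType R) D h N (G : nat -> V) : 0 < h ->
  strongly_measurable D (fun t => G (cell h N t)).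
Proof.
by move=> h0; exists (fun _ => G \o cell h N); split=> [_|t _];
  [exact: simple_fun_cell|exact: cvg_cst].
Qed.

(** The integral of the velocity is exact up to the beginning of the cell of s; only the
    incomplete cell, of length at most h, contributes an error. *)
Lemma discrete_weak_formula h N U phi (s : R) : 0 < h ->
  discrete_solution f C u0 rho M q h N U -> contractive phi -> 0 <= s <= N%:R * h ->
  `|(phi (position h N U s) : R) - phi u0 -
     \int[mu]_(t in `[0, s[) phi (velocity h N U t)| <= 2 * M * h.
Proof.
move=> h0 hU cphi sN.
have /andP[cs sc] := cell_itv h0 sN.
have [_ _ _ vM _] := discrete_solution_cell s h0 hU.
have [U0 _] := hU.
rewrite /velocity (Rintegral_cell h0 (fun k => phi (h^-1 *: (U k.+1 - U k)) : R) sN).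
have tel j : h * \sum_(i < j) (phi (h^-1 *: (U i.+1 - U i)) : R) = (phi (U j) : R) - phi u0.
  elim: j => [|j ih]; first by rewrite big_ord0 mulr0 U0 subrr.
  by rewrite big_ord_recr mulrDr ih/= dualZ dualB mulVKf ?gt_eqF//; ring.
rewrite tel opprD addrA subrr sub0r normrN normrM mulrC ler_pM//.
  by rewrite (le_trans (cphi _)).
rewrite ger0_norm ?subr_ge0// lerBlDr.
by rewrite -natr1 mulrDl mul1r addrC in sc; exact: ltW.
Qed.

End interpolation.

Section limit_of_scheme.
Context {R : realType} {B : normedModType R}.
Local Notation mu := (@lebesgue_measure R).
Variables (f : B -> B) (C : set B) (u0 : B) (rho M q T : R).
Hypothesis smooth : uniformly_smooth B.
Hypothesis cf : continuous f.
Hypothesis rho0 : 0 <= rho.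
Hypothesis M0 : 0 <= M.
Hypothesis q0 : 0 < q.
Hypothesis T0 : 0 < T.
Local Notation D := (`[0, T]%classic : set R).

(** Stated for sequences, so that passing to a subsequence stays within the definition. *)
Definition approximation (h : nat -> R) (N : nat -> nat) (U : nat -> nat -> B) :=
  [/\ forall n, 0 < h n, forall n, (N n)%:R * h n = T, h n @[n --> \oo] --> (0 : R) &
      forall n, discrete_solution f C u0 rho M q (h n) (N n) (U n)].

Lemma approximation_subsequence h N U (k : nat -> nat) : k @ \oo --> \oo ->
  approximation h N U -> approximation (h \o k) (N \o k) (U \o k).
Proof.
move=> koo [h0 hN hoo hU]; split=> [n|n||n].
- exact: h0.
- exact: hN.
- exact: cvg_comp koo hoo.
- exact: hU.
Qed.

Let mD : measurable D. Proof. exact: measurable_itv. Qed.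
Let muD : (mu D < +oo)%E.
Proof. by rewrite lebesgue_measure_itv/=; case: ifP => // _; rewrite -EFinD ltry. Qed.

Variables (h : nat -> R) (N : nat -> nat) (U : nat -> nat -> B).
Hypothesis happ : approximation h N U.
Local Notation pos := (fun n => position (h n) (N n) (U n)).
Local Notation vel := (fun n => velocity (h n) (N n) (U n)).
Local Notation nrm := (fun n => normal_part f (h n) (N n) (U n)).

Let h0 n : 0 < h n. Proof. by have [] := happ. Qed.
Let hN n : (N n)%:R * h n = T. Proof. by have [] := happ. Qed.
Let hU n : discrete_solution f C u0 rho M q (h n) (N n) (U n).
Proof. by have [] := happ. Qed.
Let Mh_cvg : 2 * M * h n @[n --> \oo] --> (0 : R).
Proof.
have [_ _ hoo _] := happ.
by rewrite -(mulr0 (2 * M)); apply: cvgM; [exact: cvg_cst|exact: hoo].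
Qed.

Lemma bounded_velocity : bounded_Linfty D vel.
Proof.
split=> [n|].
  exact: (strongly_measurable_cell _ (N n) (fun k => (h n)^-1 *: (U n k.+1 - U n k))).
exists (2 * M) => n; apply: aeW => t _.
by have [] := discrete_solution_cell t (h0 n) (hU n).
Qed.

Let strongly_measurable_nrm n : strongly_measurable D (nrm n).
Proof.
exact: (strongly_measurable_cell _ (N n) (fun k => f (U n k) - (h n)^-1 *: (U n k.+1 - U n k))).
Qed.

Let nrmM n t : `|nrm n t| <= M.
Proof. by have [_ _ _ _ []] := discrete_solution_cell t (h0 n) (hU n). Qed.

Lemma bounded_normal_part : bounded_Linfty D nrm.
Proof. by split=> [//|]; exists M => n; exact: aeW. Qed.

Lemma weak_formula_cvg phi (s : R) : contractive phi -> 0 <= s <= T ->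
  (phi (pos n s) : R) - phi u0 - \int[mu]_(t in `[0, s[) phi (vel n t)
    @[n --> \oo] --> (0 : R).
Proof.
move=> cphi sT.
have Mh_cvgN : - (2 * M * h n) @[n --> \oo] --> (0 : R).
  by rewrite -oppr0; exact: cvgN Mh_cvg.
apply: squeeze_cvgr Mh_cvgN Mh_cvg; apply: nearW => n /=; rewrite -ler_norml.
by apply: (discrete_weak_formula (h0 n) (hU n)); rewrite ?hN.
Qed.

(** The positions lie in a fixed compact set, so weak convergence of the velocities, which
    gives convergence of phi (pos n s) for each norming functional phi, is
    enough for strong convergence at every time. *)
Lemma position_cvg (y : R -> B) : ball_compact C -> Linfty_weak_cvg D vel y ->
  exists u : R -> B, forall s, D s -> pos n s @[n --> \oo] --> u s.
Proof.
move=> Cc wy.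
pose K := closed_ball (0 : B) (rho + 1) `&` C.
have cK : compact K by apply: Cc; rewrite ltr_pwDr.
have KU n t : K (pos n t).
  have [[CU Ur] _ _ _ _] := discrete_solution_cell t (h0 n) (hU n); split=> //.
  rewrite closed_ballE ?ltr_pwDr// /closed_ball_ /= sub0r normrN.
  by rewrite (le_trans Ur)// lerDl.
suff /choice[u hu] : forall s : R, exists l : B, D s -> pos n s @[n --> \oo] --> l by exists u.
move=> s; have [sT|nsT] := pselect (D s); last by exists 0.
have [|phi cphi|l hl] := compact_weak_cvg smooth (u := fun n => pos n s) cK.
- by move=> n; exact: KU.
- exists ((phi u0 : R) + \int[mu]_(t in `[0, s[) phi (y t)).
  rewrite /= in_itv/= in sT.
  have z0 := weak_formula_cvg cphi sT.
  have wys := Linfty_weak_cvg_itv (phi := phi) wy sT.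
  rewrite -[X in _ --> X]add0r.
  have -> : (fun n => phi (pos n s) : R) = (fun n =>
      ((phi (pos n s) : R) - phi u0 - \int[mu]_(t in `[0, s[) phi (vel n t))
      + ((phi u0 : R) + \int[mu]_(t in `[0, s[) phi (vel n t))).
    by apply/funext => n; ring.
  by apply: cvgD => //; apply: cvgD => //; exact: cvg_cst.
- by exists l.
Qed.

Variables (u y : R -> B) (Ky : R).
Hypothesis u_cvg : forall s, D s -> pos n s @[n --> \oo] --> u s.
Hypothesis my : strongly_measurable D y.
Hypothesis yK : ess_bounded D Ky y.
Hypothesis nrm_weak_cvg : Linfty_weak_cvg D nrm y.

Let limit_norm_le (E : normedModType R) (z : nat -> E) (l : E) (b : R) :
  z @ \oo --> l -> (forall n, `|z n| <= b) -> `|l| <= b.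
Proof.
move=> zl zb; have cz : `|z n| @[n --> \oo] --> `|l| by apply: cvg_norm; exact: zl.
rewrite -(cvg_lim _ cz)//; apply: limr_le; last exact: nearW.
by apply/cvg_ex; exists `|l|.
Qed.

Let fu_cvg s : D s -> f (pos n s) @[n --> \oo] --> f (u s).
Proof. by move=> sT; apply: cvg_comp (u_cvg sT) _; exact: cf. Qed.

Lemma limit_in_set s : closed C -> D s -> C (u s).
Proof.
move=> closedC sT; apply: (closed_cvg C closedC _ _ (u_cvg sT)).
by apply: nearW => n; have [[]] := discrete_solution_cell s (h0 n) (hU n).
Qed.

Let u_rho s : D s -> `|u s| <= rho.
Proof.
move=> /u_cvg/limit_norm_le; apply => n.
by have [[]] := discrete_solution_cell s (h0 n) (hU n).
Qed.

Let fu_M s : D s -> `|f (u s)| <= M.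
Proof.
move=> /fu_cvg/limit_norm_le; apply => n.
by have [] := discrete_solution_cell s (h0 n) (hU n).
Qed.

Let strongly_measurable_u : strongly_measurable D u.
Proof. by exists pos; split=> [n|t /u_cvg//]; exact: simple_fun_cell. Qed.

Lemma limit_init : u 0 = u0.
Proof.
have T00 : D 0 by rewrite /= in_itv/= lexx ltW.
apply: (cvg_unique _ (u_cvg T00)) => //.
apply: cvg_near_cst; apply: nearW => n; rewrite /position (@cellE _ _ _ (h0 n) 0 0)//.
- by have [] := hU n.
- by rewrite mul0r.
- by rewrite mul1r.
Qed.

Lemma strongly_measurable_limit_velocity : strongly_measurable D (fun t => f (u t) - y t).
Proof.
by apply: strongly_measurableB => //; exact: strongly_measurable_comp.
Qed.

Lemma ess_bounded_limit_velocity : ess_bounded D (M + Ky) (fun t => f (u t) - y t).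
Proof.
move: yK; apply: (@filterS _ _ (ae_filter_ringOfSetsType mu)) => t hy Dt.
by rewrite (le_trans (ler_normB _ _))// lerD ?hy ?fu_M.
Qed.

(** The velocity is f (pos) minus the normal part: the first term converges strongly and
    boundedly, the second one weakly, so the discrete formula passes to the limit. *)
Lemma limit_weak_formula phi (s : R) : contractive phi -> 0 <= s <= T ->
  phi (u s) = (phi (u 0) : R) + \int[mu]_(t in `[0, s[) phi (f (u t) - y t).
Proof.
move=> cphi sT.
have Ds : D s by rewrite /= in_itv.
have sD : `[0, s[ `<=` D.
  move=> t; rewrite /= !in_itv/= => /andP[t0 /ltW ts].
  by apply/andP; split=> //; case/andP: sT => _; exact: le_trans.
have mS : measurable (`[0, s[%classic : set R) by exact: measurable_itv.
have muS : (mu `[0%R, s[%classic < +oo)%E.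
  by rewrite lebesgue_measure_itv/=; case: ifP => // _; rewrite -EFinD ltry.
have mphi (z : R -> B) : strongly_measurable D z ->
    measurable_fun (`[0, s[%classic : set R) (fun t => phi (z t) : R).
  move=> mz; apply: (measurable_funS mD) => //.
  apply: (@strongly_measurable_real R D (fun t => phi (z t))) => //.
  apply: (@strongly_measurable_comp R D B R^o phi z) => //.
  exact: dual_continuous.
have iphi (z : R -> B) (Z : R) : strongly_measurable D z -> ess_bounded D Z z ->
    mu.-integrable (`[0, s[%classic : set R) (EFin \o (fun t => phi (z t) : R)).
  move=> mz zZ; apply: (integrable_ae_bounded mS muS (M := Z)); first exact: mphi.
  move: zZ; apply: (@filterS _ _ (ae_filter_ringOfSetsType mu)) => t hz /sD Dt.
  by rewrite (le_trans (cphi _))// hz.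
have fposM n t : `|f (pos n t)| <= M.
  by have [] := discrete_solution_cell t (h0 n) (hU n).
have mfpos n : strongly_measurable D (fun t => f (pos n t)).
  exact: (strongly_measurable_cell _ _ (fun k => f (U n k))).
have fpos_cvg : \int[mu]_(t in `[0, s[) (phi (f (pos n t)) : R) @[n --> \oo] -->
    \int[mu]_(t in `[0, s[) (phi (f (u t)) : R).
  apply: (Rintegral_cvg_bounded (M := M)) => //.
  - by move=> n; exact: mphi.
  - by move=> n t _; apply: le_trans (cphi _) _.
  - by move=> t /sD Dt; apply: cvg_comp (fu_cvg Dt) _; exact: dual_continuous.
have nrm_cvg := Linfty_weak_cvg_itv (phi := phi) nrm_weak_cvg sT.
have vel_cvg : \int[mu]_(t in `[0, s[) (phi (vel n t) : R) @[n --> \oo] -->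
    \int[mu]_(t in `[0, s[) (phi (f (u t)) : R) - \int[mu]_(t in `[0, s[) (phi (y t) : R).
  have -> : (fun n => \int[mu]_(t in `[0, s[) (phi (vel n t) : R)) =
      (fun n => \int[mu]_(t in `[0, s[) (phi (f (pos n t)) : R)
                - \int[mu]_(t in `[0, s[) (phi (nrm n t) : R)).
    apply/funext => n; rewrite -(@RintegralB _ _ _ mu)//.
    - by apply: eq_Rintegral => t _; rewrite -dualB /normal_part opprB addrC subrK.
    - by apply: (iphi _ M) => //; exact: aeW.
    - by apply: (iphi _ M) => //; exact: aeW.
  exact: cvgB.
have pos_cvg : (phi (pos n s) : R) @[n --> \oo] --> (phi (u s) : R).
  by apply: cvg_comp (u_cvg Ds) _; exact: dual_continuous.
have limE : (phi (u s) : R) - phi u0 - (\int[mu]_(t in `[0, s[) (phi (f (u t)) : R)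
    - \int[mu]_(t in `[0, s[) (phi (y t) : R)) = 0.
  apply: cvg_unique (weak_formula_cvg cphi sT); first exact: Rhausdorff.
  by apply: cvgB => //; apply: cvgB => //; exact: cvg_cst.
rewrite limit_init.
have -> : \int[mu]_(t in `[0, s[) (phi (f (u t) - y t) : R) =
    \int[mu]_(t in `[0, s[) (phi (f (u t)) : R) - \int[mu]_(t in `[0, s[) (phi (y t) : R).
  rewrite -(@RintegralB _ _ _ mu)//.
  - by apply: eq_Rintegral => t _; exact: dualB.
  - apply: (iphi _ M); first exact: strongly_measurable_comp.
    by apply: aeW => t Dt; exact: fu_M.
  - exact: (iphi _ Ky).
by move: limE; set A := Rintegral _ _ _; set A' := Rintegral _ _ _; lra.
Qed.

Variable p : R.
Hypothesis p2 : 2 <= p.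
Hypothesis duality_cvg : forall (z : R -> B) (phi : R -> R),
  Linfty_space D z -> mu.-integrable D (EFin \o phi) ->
  \int[mu]_(t in D) ((duality_map p (z t + nrm n t) (nrm n t)
                       - duality_map p (nrm n t) (nrm n t)) * phi t)
    @[n --> \oo] -->
  \int[mu]_(t in D) ((duality_map p (z t + y t) (y t) - duality_map p (y t) (y t)) * phi t).

(** Each discrete normal satisfies |d| <= |w + d| with w = (next - x) / q; replacing
    w by its strong limit costs an error that tends to 0. *)
Lemma limit_normal x : C x ->
  {ae mu, forall t, D t -> `|y t| <= `|q^-1 *: (u t - x) + y t|}.
Proof.
move=> Cx.
pose next n := next_position (h n) (N n) (U n).
(* W bounds w and Kp / q^-1 is a Lipschitz constant of |.|^p on the ball of radius W + M. *)
pose W := q^-1 * (rho + 2 * M * T + `|x|).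
pose Kp := p * (W + M + 1) `^ p * q^-1.
have p0 : 0 < p by rewrite (lt_le_trans _ p2).
have hT n : h n <= T.
  rewrite -(hN n) ler_peMl ?(ltW (h0 n))// ler1n lt0n.
  by apply/eqP => N0; have := hN n; rewrite N0 mul0r => /eqP; rewrite lt_eqF.
have next_pos n t : `|next n t - pos n t| <= 2 * M * h n.
  by have [] := discrete_solution_cell t (h0 n) (hU n).
have next_le n t : `|next n t| <= rho + 2 * M * T.
  rewrite -[next n t](subrK (pos n t)) addrC (le_trans (ler_normD _ _))// lerD//.
    by have [[]] := discrete_solution_cell t (h0 n) (hU n).
  by rewrite (le_trans (next_pos _ _))// ler_wpM2l// mulr_ge0.
have shift_le (v : B) : `|v| <= rho + 2 * M * T -> `|q^-1 *: (v - x)| <= W.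
  move=> vb; rewrite normrZ gtr0_norm ?invr_gt0// ler_pM2l ?invr_gt0//.
  by rewrite (le_trans (ler_normB _ _))// lerD2r.
have MT0 : 0 <= 2 * M * T by rewrite mulr_ge0 ?(ltW T0)// mulr_ge0.
have W0 : 0 <= W by rewrite mulr_ge0 ?invr_ge0 ?(ltW q0)// !addr_ge0.
have Kp0 : 0 <= Kp.
  by rewrite mulr_ge0 ?invr_ge0 ?(ltW q0)// mulr_ge0 ?powR_ge0// ltW.
have mdist n : measurable_fun D (fun t => `|next n t - u t|).
  apply: (@strongly_measurable_real R D (fun t => `|next n t - u t|)) => //.
  apply: (@strongly_measurable_comp R D B R^o (fun v => `|v|) (fun t => next n t - u t)).
    by move=> v; exact: norm_continuous.
  apply: strongly_measurableB => //.
  exact: (strongly_measurable_cell D (N n) (fun k => U n k.+1) (h0 n)).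
have dist_cvg t : D t -> `|next n t - u t| @[n --> \oo] --> (0 : R).
  move=> Dt; have c0 : cst 0 @ \oo --> (0 : R) by exact: cvg_cst.
  have c1 : 2 * M * h n + `|pos n t - u t| @[n --> \oo] --> (0 : R).
    rewrite -[X in _ --> X]addr0; apply: cvgD; first exact: Mh_cvg.
    rewrite -(@normr0 _ B) -(subrr (u t)); apply: cvg_norm; apply: cvgB; last exact: cvg_cst.
    exact: u_cvg.
  apply: squeeze_cvgr c0 c1; apply: nearW => n /=; rewrite normr_ge0/=.
  by rewrite (le_trans (ler_distD (pos n t) _ _))// lerD2r next_pos.
apply: (@norm_weak_limit_le R B smooth p p2 D nrm y (fun t => q^-1 *: (u t - x))
   (fun n t => Kp * `|next n t - u t|) (M + `|Ky|) W (Kp * (rho + 2 * M * T + rho))) => //.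
- move=> n; apply: aeW => t _; apply: le_trans (nrmM n t) _.
  by rewrite lerDl.
- move: yK; apply: (@filterS _ _ (ae_filter_ringOfSetsType mu)) => t hy Dt.
  by rewrite (le_trans (hy Dt))// (le_trans (ler_norm _))// lerDr.
- apply: strongly_measurableZ; apply: strongly_measurableB => //.
  exact: strongly_measurable_cst.
- by move=> t Dt; apply: shift_le; rewrite (le_trans (u_rho Dt))// lerDl.
- by move=> n; exact: measurable_funM.
- move=> n t Dt; rewrite normrM normr_id ger0_norm// ler_wpM2l//.
  by rewrite (le_trans (ler_normB _ _))// lerD// u_rho.
- move=> t Dt; rewrite -(mulr0 Kp); apply: cvgM; first exact: cvg_cst.
  exact: dist_cvg.
move=> n t Dt; set a := q^-1 *: (next n t - x) + nrm n t.
set b := q^-1 *: (u t - x) + nrm n t.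
have da : `|nrm n t| <= `|a|.
  rewrite -(ler_pM2l q0) -[X in _ <= X * _](gtr0_norm q0) -normrZ /a scalerDr scalerA.
  rewrite mulfV ?gt_eqF// scale1r addrC.
  by have [_ _ _ _ [_]] := discrete_solution_cell t (h0 n) (hU n); exact.
have aW : `|a| <= W + M.
  by rewrite (le_trans (ler_normD _ _))// lerD ?nrmM ?shift_le.
have ab : `|a - b| = q^-1 * `|next n t - u t|.
  rewrite /a /b opprD addrACA subrr addr0 -scalerBr opprB addrA subrK.
  by rewrite normrZ gtr0_norm ?invr_gt0.
have := norm_powR_lipschitz smooth p2 a b; rewrite lerBlDl ab => h1.
apply: (@le_trans _ _ (`|a| `^ p)); first by rewrite ge0_ler_powR ?nnegrE ?(ltW p0).
rewrite (le_trans h1)// lerD2l /Kp -!mulrA ler_pM2l// mulrA.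
rewrite -[leRHS]mulrA ler_wpM2r ?mulr_ge0 ?invr_ge0 ?(ltW q0)//.
by rewrite ge0_ler_powR ?nnegrE ?(ltW p0) ?addr_ge0// lerD2r.
Qed.

End limit_of_scheme.

Local Notation mu := (@lebesgue_measure _).

Lemma approximation_exists (R : realType) (B : normedModType R) (r L T : R)
    (f : B -> B) (C : set B) (u0 : B) :
  prox_regular r f C -> 0 < r -> C u0 -> 0 < L -> 0 < T ->
  (forall x, `|f x| <= L * (1 + `|x|)) ->
  let M := L * (expR (2 * L * T) * (1 + `|u0|)) in
  exists h N U, approximation f C u0 (M / L) M (r / M) T h N U.
Proof.
move=> prox r0 Cu0 L0 T0 fL M.
have M0 : 0 < M by rewrite mulr_gt0 ?mulr_gt0 ?expR_gt0// ltr_pwDl.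
(* The shift n0 makes every step short enough: h n * M < r. *)
pose n0 := Num.truncn (T * M / r).
pose N n := (n + n0).+1; pose h n : R := T / (N n)%:R.
have h0 n : 0 < h n by rewrite divr_gt0.
have hN n : h n * (N n)%:R = T by rewrite /h divfK// pnatr_eq0.
have hM n : h n * M < r.
  rewrite /h mulrAC ltr_pdivrMr// [ltRHS]mulrC -ltr_pdivrMr//.
  by rewrite (lt_le_trans (truncnS_gt _))// ler_nat /N ltnS leq_addl.
have /choice[U hU] n := discrete_solution_exists prox r0 Cu0 L0 (ltW T0) fL (h0 n) (hN n) (hM n).
exists h, N, U; split=> // [n|].
  by rewrite mulrC hN.
rewrite -(mulr0 T); apply: cvgM; first exact: cvg_cst.
apply: (cvg_comp _ (@harmonic R) _ (@cvg_harmonic R)).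
by apply: (@increasing_cvg_infty (addn^~ n0)) => i j; rewrite ltn_add2r.
Qed.

Lemma lipschitz_absolutely_continuous (R : realType) (B : normedModType R) (K a b : R)
    (u : R -> B) : 0 <= K ->
  (forall s t, a <= s -> s <= t -> t <= b -> `|u t - u s| <= K * (t - s)) ->
  absolutely_continuous a b u.
Proof.
move=> K0 lip e e0; exists (e / (K + 1)); first by rewrite divr_gt0// ltr_wpDl.
move=> n s t st _ hsum.
apply: (@le_lt_trans _ _ (\sum_(i < n) K * (t i - s i))).
  by apply: ler_sum => i _; have /and3P[? ? ?] := st i; exact: lip.
rewrite -mulr_sumr.
have sum0 : 0 <= \sum_(i < n) (t i - s i).
  by apply: sumr_ge0 => i _; rewrite subr_ge0; have /and3P[] := st i.
apply: (@le_lt_trans _ _ ((K + 1) * \sum_(i < n) (t i - s i))).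
  by rewrite ler_wpM2r// lerDl.
by rewrite mulrC -ltr_pdivlMr// ltr_wpDl.
Qed.

(** Testing against a dense part of C suffices because both sides are continuous in c. *)
Lemma normal_cone_dense (R : realType) (B : normedModType R) (C : set B) (u v : B) (q : R)
    (c : nat -> nat -> B) : 0 < q -> C u ->
  (forall x (e : R), C x -> 0 < e -> exists i j, `|x - c i j| < e) ->
  (forall i j, `|v| <= `|q^-1 *: (u - c i j) + v|) -> normal_cone C u v.
Proof.
move=> q0 Cu cdense vc; exists q => //; split=> //.
rewrite addrAC subrr add0r normrZ gtr0_norm//.
apply/eqP; rewrite eq_le; apply/andP; split; last first.
  by rewrite (le_trans (dist_set_le _ Cu))// addrAC subrr add0r normrZ gtr0_norm.
apply: lb_le_inf; first by exists `|u + q *: v - u|, u.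
move=> _ [x Cx <-]; apply/ler_addgt0Pr => /= e e0.
have [i [j xc]] := cdense x e Cx e0.
have := vc i j; rewrite -(ler_pM2l q0) => /le_trans; apply.
rewrite -[X in X * _](gtr0_norm q0) -normrZ scalerDr scalerA mulfV ?gt_eqF// scale1r.
by rewrite [u - _ + _]addrAC (le_trans (ler_distD x _ _))// lerD2l ltW.
Qed.

Theorem theorem1p1 (R : realType) (T : R) (hT : 0 <= T)
    (B : completeNormedModType R)
    (hsep : separable_space B) (hrefl : reflexive_space B) (hsmooth : uniformly_smooth B)
    (p : R) (hp : 2 <= p) (hswc : smoothly_weakly_compact B `[0, T] p)
    (f : B -> B) (hf : continuous f) (hfL : linear_growth f)
    (r : R) (hr : 0 < r)
    (C : set B) (hC0 : C !=set0) (hCc : ball_compact C)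
    (hCr : prox_regular r f C) (u0 : B) (hu0 : C u0) :
  exists u : R -> B,
    [/\ absolutely_continuous 0 T u,
        {ae lebesgue_measure, forall t, t \in `[0, T] ->
          derivable u t 1 /\
          exists2 v, normal_cone C (u t) v & derive1 u t + v = f (u t)},
        u 0 = u0 &
        forall t, t \in `[0, T] -> C (u t)].
Proof.
(* A degenerate time interval is negligible: the constant function is a solution. *)
have [T0|Tneq] := eqVneq T 0.
  exists (fun=> u0); split=> //.
    by apply: (@lipschitz_absolutely_continuous _ _ 0) => // *; rewrite subrr normr0 mul0r.
  move: (@ae_neq R 0); apply: (@filterS _ _ (ae_filter_ringOfSetsType mu)) => t t0.
  rewrite in_itv/= T0 => /andP[t1 t2].
  by move: t0; rewrite (@le_anti _ _ t 0) ?t1 ?t2 ?eqxx.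
have T0 : 0 < T by rewrite lt_neqAle eq_sym Tneq.
have [L L0 fL] := hfL.
have [h [N [U]]] := approximation_exists hCr hr hu0 L0 T0 fL.
set M := L * _; set rho := M / L; set q := r / M => happ.
have M0 : 0 < M by rewrite mulr_gt0 ?mulr_gt0 ?expR_gt0// ltr_pwDl.
have q0 : 0 < q by rewrite divr_gt0.
have rho0 : 0 <= rho by rewrite divr_ge0 ?(ltW M0) ?(ltW L0).
(* The first subsequence makes the velocities converge weakly, hence the positions strongly. *)
have [k1 [k1inc [y1 [_ weak1 _]]]] := hswc _ (bounded_velocity happ).
have {}happ := approximation_subsequence (increasing_cvg_infty k1inc) happ.
have [u u_cvg1] := position_cvg hsmooth rho0 happ hCc weak1.
(* The second one provides the weak limit of the normals and the convergence of the duality terms. *)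
have [k2 [k2inc [y [[my [Ky yK]] weak2 duality_cvg]]]] := hswc _ (bounded_normal_part happ).
have k2oo := increasing_cvg_infty k2inc.
have {}happ := approximation_subsequence k2oo happ.
have u_cvg s : `[0, T]%classic s -> position (h (k1 (k2 n))) (N (k1 (k2 n))) (U (k1 (k2 n))) s
    @[n --> \oo] --> u s.
  by move=> Ds; exact: cvg_comp k2oo (u_cvg1 s Ds).
have Cu s : `[0, T]%classic s -> C (u s).
  by apply: (limit_in_set happ u_cvg); exact: hCr.1.
have mg := strongly_measurable_limit_velocity hf u_cvg my.
have gK := ess_bounded_limit_velocity hf happ u_cvg yK.
have ug := limit_weak_formula hf T0 happ u_cvg my yK weak2.
have [c [Cc cdense]] := dense_sequence_in hsep hu0.
have normal i j := limit_normal hsmooth rho0 (ltW M0) q0 T0 happ u_cvg my yK hp duality_cvg (Cc i j).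
exists u; split; last exact: Cu.
- apply: (@lipschitz_absolutely_continuous _ _ `|M + Ky|) => // a b.
  exact: (primitive_lipschitz hsmooth mg gK (fun phi s => @ug phi s)).
- have deriv := primitive_derivable hsmooth mg gK (fun phi s => @ug phi s) hsep.
  move: deriv (@ae_foralln _ _ _ mu _ (fun i => @ae_foralln _ _ _ mu _ (normal i))).
  apply: (@filterS2 _ _ (ae_filter_ringOfSetsType mu)) => t dt nt Dt.
  have [du dE] := dt Dt; split=> //; exists (y t); last by rewrite dE subrK.
  by apply: (normal_cone_dense q0 (Cu t Dt) cdense) => i j; exact: nt.
- exact: (limit_init T0 happ u_cvg).
Qed.
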